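(* Let $u\in\mathcal U$ be an admissible control, let $u^*\in\mathcal U$ be the optimal control, let $\mathbb P^u,\mathbb P^{u^*}$ be the associated path measures, and let $\delta=u^*-u$. Then the relative error $r(u)$ satisfies $$r(u)\ \ge\ \left(\exp\left(\operatorname{KL}(\mathbb P^{u^*}|\mathbb P^u)\right)-1\right)^{\frac12}$$ and therefore $$r(u)\ \ge\ \left(\exp\left(\mathbb E\left[\frac12\int_0^T|\delta(X_s^{u^*},s)|^2\,\mathrm ds\right]\right)-1\right)^{\frac12}.$$
   Context: Setting. Let $0<T<\infty$, $b:\mathbb R^d\times[0,T]\to\mathbb R^d$, $\sigma:\mathbb R^d\times[0,T]\to\mathbb R^{d\times d}$ with $\sigma(x,s)$ invertible, $x_{\mathrm{init}}\in\mathbb R^d$ deterministic, $W$ a standard $d$-dimensional Brownian motion, and let $X$ solve $\mathrm dX_s=b(X_s,s)\,\mathrm ds+\sigma(X_s,s)\,\mathrm dW_s$, $X_0=x_{\mathrm{init}}$, on $[0,T]$. For given $f:\mathbb R^d\times[0,T]\to\mathbb R$ and $g:\mathbb R^d\to\mathbb R$ set $\mathcal W(X)=\int_0^T f(X_s,s)\,\mathrm ds+g(X_T)$ and $\mathcal Z=\mathbb E[e^{-\mathcal W(X)}]$, assumed finite. For a control $u:\mathbb R^d\times[0,T]\to\mathbb R^d$ let $X^u$ solve $\mathrm dX^u_s=\left(b(X^u_s,s)+\sigma(X^u_s,s)u(X^u_s,s)\right)\mathrm ds+\sigma(X^u_s,s)\,\mathrm dW_s$, $X^u_0=x_{\mathrm{init}}$.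 Let $\mathbb P$ and $\mathbb P^u$ be the laws of $X$ and $X^u$ on the path space $\mathcal C$ of continuous functions $[0,T]\to\mathbb R^d$ starting at $x_{\mathrm{init}}$ (Borel $\sigma$-algebra of the supremum norm). All coefficients are measurable and the uncontrolled SDE is well posed. $\mathcal U$ denotes the set of admissible (measurable) controls, i.e. those for which the controlled SDE has a unique strong solution, and $\mathbb P$ and $\mathbb P^u$ are equivalent with Girsanov density $$\frac{\mathrm d\mathbb P^u}{\mathrm d\mathbb P}(X)=\exp\left(\int_0^T(u^\top\sigma^{-1})(X_s,s)\cdot\mathrm dX_s-\int_0^T(\sigma^{-1}b\cdot u)(X_s,s)\,\mathrm ds-\frac12\int_0^T|u(X_s,s)|^2\,\mathrm ds\right).$$ The optimal control $u^*\in\mathcal U$ is assumed to exist and is characterized by $\mathbb P^{u^*}=\mathbb Q$, where $\frac{\mathrm d\mathbb Q}{\mathrm d\mathbb P}=\frac{e^{-\mathcal W}}{\mathcal Z}$. The relative error is $r(u)=\frac1{\mathcal Z}\sqrt{\operatorname{Var}\left(e^{-\mathcal W(X^u)}\frac{\mathrm d\mathbb P}{\mathrm d\mathbb P^u}(X^u)\right)}\in[0,\infty]$, and $\operatorname{KL}(\mu|\lambda)=\mathbb E_\mu\left[\log\frac{\mathrm d\mu}{\mathrm d\lambda}\right]$. *)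

(* Defs.v *)
From HB Require Import structures.
From mathcomp Require Import all_boot all_order all_algebra.
From mathcomp Require Import all_classical all_reals all_analysis.

Set Implicit Arguments.
Unset Strict Implicit.
Unset Printing Implicit Defensive.

Import Order.TTheory GRing.Theory Num.Theory.
Import numFieldNormedType.Exports.

Local Open Scope classical_set_scope.
Local Open Scope ring_scope.

Notation vec R d := 'cV[R]_d.

Notation borelMx R m n := (g_sigma_algebraType (@open 'M[R]_(m, n))).

Notation leb := lebesgue_measure.

Definition dot (R : realType) (d : nat) (x y : vec R d) : R := (x^T *m y) 0 0.

(* The square of the Euclidean norm; the norm [`|x|] of the library on matrices
   is the max norm. *)
Definition sqnorm (R : realType) (d : nat) (x : vec R d) : R := dot x x.

Section path_space.
Context (R : realType) (d : nat).

(* A path is a function on [0, T]; its values at other times carry no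
   information and are fixed, so that equal paths are equal functions. *)
Record cpath (T : R) (x0 : vec R d) := Path {
  path_fun :> R -> vec R d ;
  path_continuous : {within `[0, T], continuous path_fun} ;
  path_init : path_fun 0 = x0 ;
  path_outside : forall t, t \notin `[0, T] -> path_fun t = x0 }.

Context (T : R) (x0 : vec R d).

Let cst_continuous : {within `[0, T], continuous (fun _ : R => x0)}.
Proof. exact/continuous_subspaceT/cst_continuous. Qed.

Definition cst_path : cpath T x0 :=
  @Path T x0 (fun=> x0) cst_continuous erefl (fun _ _ => erefl).

HB.instance Definition _ := gen_eqMixin (cpath T x0).
HB.instance Definition _ := gen_choiceMixin (cpath T x0).
HB.instance Definition _ := isPointed.Build (cpath T x0) cst_path.

(* Open sets of the supremum norm. By compactness of [0, T], the bound holds at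
   all times iff the supremum of the norm is less than e. The max norm on the
   values yields the same topology as the Euclidean one. *)
Definition path_open : set (set (cpath T x0)) :=
  [set A : set (cpath T x0) | forall w, A w -> exists2 e : R, 0 < e &
     forall w' : cpath T x0,
       (forall t, t \in `[0, T] -> `|w' t - w t| < e) -> A w'].

End path_space.

Notation pathSpace T x0 := (g_sigma_algebraType (@path_open _ _ T x0)).

Definition ev (R : realType) (d : nat) (T : R) (x0 : vec R d)
  (w : pathSpace T x0) : R -> vec R d := path_fun w.

Section brownian.
Context (R : realType) (d : nat) (T : R).
Context (dO : measure_display) (O : measurableType dO) (P : probability O R).
Variable W : {mfun O >-> pathSpace T (0 : vec R d)}.

Definition history (t : R) : set (set O) :=
  <<s [set A | exists s, s \in `[0, t] /\
         exists B : set (borelMx R d 1), measurable B /\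
           A = [set w | B (ev (W w) s)]] >>.

Definition filtration (t : R) : set (set O) :=
  [set A | measurable A /\
     exists2 B, history t B & P.-negligible ((A `\` B) `|` (B `\` A))].

(* The increments are independent of the past and have law N(0, (t - s) I);
   the second argument of [normal_prob] is the standard deviation. Continuity
   and W_0 = 0 are part of the type of W. *)
Definition is_brownian : Prop :=
  forall s t : R, 0 <= s -> s < t -> t <= T ->
  forall A, history s A ->
  forall B : 'I_d -> set R, (forall i, measurable (B i)) ->
    P (A `&` [set w | forall i, B i ((ev (W w) t - ev (W w) s) i 0)]) =
    (P A * \big[mule/1]_(i < d) normal_prob 0 (Num.sqrt (t - s)) (B i))%E.

Definition measurable_wrt m n (F : set (set O)) (X : O -> 'M[R]_(m, n)) :=
  forall B : set (borelMx R m n), measurable B -> F (X @^-1` B).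

Record simple_process := SimpleProcess {
  sp_size : nat ;
  sp_time : nat -> R ;
  sp_val : nat -> O -> vec R d ;
  sp_time_ge0 : 0 <= sp_time 0%N ;
  sp_time_nd : {homo sp_time : j k / (j <= k)%N >-> j <= k} ;
  sp_time_leT : sp_time sp_size <= T ;
  sp_adapted : forall k, (k < sp_size)%N ->
    measurable_wrt (filtration (sp_time k)) (sp_val k) ;
  sp_bounded : exists M : R,
    forall k w, (k < sp_size)%N -> `|sp_val k w| <= M }.

Definition sp_eval (S : simple_process) (s : R) (w : O) : vec R d :=
  \sum_(k < sp_size S)
    (\1_(`]sp_time S k, sp_time S k.+1]) s : R) *: sp_val S k w.

Definition sp_int (S : simple_process) (t : R) (w : O) : R :=
  \sum_(k < sp_size S)
    dot (sp_val S k w) (ev (W w) (Num.min t (sp_time S k.+1))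
                        - ev (W w) (Num.min t (sp_time S k))).

Definition cvg0_in_probability (Y : nat -> O -> \bar R) : Prop :=
  forall e : R, 0 < e ->
    (P [set w | (e%:E <= `|Y n w|)%E] @[n --> \oo] --> 0%E).

(* [is_ito_integral H I]: I is a version of the process
   t |-> \int_0^t H_s . dW_s. The process H is in the closure of the simple
   ones, hence \int_0^T |H_s|^2 ds < +oo almost surely. *)
Definition is_ito_integral (H : R -> O -> vec R d) (I : R -> O -> R) : Prop :=
  [/\ measurable_fun (`[0, T]%classic `*` [set: O])
        (fun z : R * O => H z.1 z.2 : borelMx R d 1),
      (forall t, t \in `[0, T] -> measurable_fun [set: O] (I t)),
      {ae P, forall w, {within `[0, T], continuous (I ^~ w)}} &
      exists S : nat -> simple_process,
        cvg0_in_probability (fun n w =>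
          \int[leb]_(s in `[0%R, T])
            (sqnorm (sp_eval (S n) s w - H s w)%R)%:E)%E /\
        forall t, t \in `[0, T] ->
          cvg0_in_probability (fun n w => (sp_int (S n) t w - I t w)%:E)].

Definition measurable_coef m n (h : vec R d -> R -> 'M[R]_(m, n)) : Prop :=
  measurable_fun ([set: borelMx R d 1] `*` `[0, T]%classic)
    (fun z : borelMx R d 1 * R => h z.1 z.2 : borelMx R m n).

Section sde.
Variables (x0 : vec R d) (sigma : vec R d -> R -> 'M[R]_d).
Implicit Type X : {mfun O >-> pathSpace T x0}.
Implicit Type beta : vec R d -> R -> vec R d.

(* dX_s = beta(X_s, s) ds + sigma(X_s, s) dW_s, where X is adapted to the
   augmented filtration of W. *)
Definition strong_solution beta X : Prop :=
  [/\ forall t, t \in `[0, T] ->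
        measurable_wrt (filtration t) (fun w => ev (X w) t),
      {ae P, forall w, forall i, leb.-integrable `[0, T]
         (fun s => (beta (ev (X w) s) s i 0)%:E)} &
      forall i : 'I_d, exists2 I : R -> O -> R,
        is_ito_integral
          (fun s w => (row i (sigma (ev (X w) s) s))^T) I &
        {ae P, forall w, forall t, t \in `[0, T] ->
          ev (X w) t i 0 =
            x0 i 0 + \int[leb]_(s in `[0, t]) beta (ev (X w) s) s i 0
            + I t w}].

Definition unique_strong_solution beta X : Prop :=
  strong_solution beta X /\
  forall Y : {mfun O >-> pathSpace T x0}, strong_solution beta Y ->
    {ae P, forall w, Y w = X w}.

(* J = \int_0^T h(X_s, s) . dX_s for a solution X of
   dX_s = beta(X_s, s) ds + sigma(X_s, s) dW_s and a row vector h, that is,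
   \int_0^T (h beta)(X_s, s) ds + \int_0^T (h sigma)(X_s, s) . dW_s. *)
Definition is_integral_dX beta X (h : vec R d -> R -> 'rV[R]_d) (J : O -> R) :
    Prop :=
  exists2 I : R -> O -> R,
    is_ito_integral (fun s w => (h (ev (X w) s) s
                                 *m sigma (ev (X w) s) s)^T) I &
    {ae P, forall w,
      leb.-integrable `[0, T]
        (fun s => ((h (ev (X w) s) s
                    *m beta (ev (X w) s) s) 0 0)%:E) /\
      J w = \int[leb]_(s in `[0, T])
              (h (ev (X w) s) s *m beta (ev (X w) s) s) 0 0
            + I T w}.

Definition controlled_drift (b u : vec R d -> R -> vec R d)
    (x : vec R d) (s : R) : vec R d := b x s + sigma x s *m u x s.

End sde.
End brownian.

Section path_measures.
Local Open Scope charge_scope.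

Definition density (R : realType) (d : measure_display) (E : measurableType d)
    (mu lambda : probability E R) : E -> \bar R :=
  'd (charge_of_finite_measure mu) '/d lambda.

Definition KL (R : realType) (d : measure_display) (E : measurableType d)
    (mu lambda : probability E R) : \bar R :=
  (\int[mu]_x lne (density mu lambda x))%E.

Context (R : realType) (d : nat) (T : R) (x0 : vec R d).
Context (dO : measure_display) (O : measurableType dO) (P : probability O R).

Definition law (X : {mfun O >-> pathSpace T x0}) :
    probability (pathSpace T x0) R := distribution P X.

Definition girsanov_density (W : {mfun O >-> pathSpace T (0 : vec R d)})
    (b : vec R d -> R -> vec R d) (sigma : vec R d -> R -> 'M[R]_d)
    (X Xu : {mfun O >-> pathSpace T x0}) (u : vec R d -> R -> vec R d) : Prop :=
  exists2 J : O -> R,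
    is_integral_dX P W sigma b X (fun x s => (u x s)^T *m invmx (sigma x s)) J &
    {ae P, forall w, density (law Xu) (law X) (X w) =
      (expR (J w
        - \int[leb]_(s in `[0, T])
            dot (invmx (sigma (ev (X w) s) s) *m b (ev (X w) s) s)
                (u (ev (X w) s) s)
        - 2^-1 * \int[leb]_(s in `[0, T]) sqnorm (u (ev (X w) s) s)))%:E}.

(* X is the uncontrolled process, Xu the process controlled by u. *)
Definition admissible (W : {mfun O >-> pathSpace T (0 : vec R d)})
    (b : vec R d -> R -> vec R d) (sigma : vec R d -> R -> 'M[R]_d)
    (X : {mfun O >-> pathSpace T x0}) (u : vec R d -> R -> vec R d)
    (Xu : {mfun O >-> pathSpace T x0}) : Prop :=
  [/\ measurable_coef T u,
      unique_strong_solution P W sigma (controlled_drift sigma b u) Xu,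
      law X `<< law Xu,
      law Xu `<< law X &
      girsanov_density W b sigma X Xu u].

Local Open Scope ereal_scope.

(* Extended-valued, so that e^{-work} = 0 where the integral is +oo; the junk
   value +oo + -oo = -oo of an undefined integral makes e^{-work} = +oo, which
   finiteness of the partition function excludes almost surely. *)
Definition work (f : vec R d -> R -> R) (g : vec R d -> R)
    (x : pathSpace T x0) : \bar R :=
  \int[leb]_(s in `[0%R, T]) (f (ev x s) s)%:E
  + (g (ev x T))%:E.

Definition partition_function (f : vec R d -> R -> R) (g : vec R d -> R)
    (X : {mfun O >-> pathSpace T x0}) : \bar R :=
  \int[P]_w expeR (- work f g (X w)).

(* The law of Xstar is the measure Q with dQ/dP = e^{-work} / Z, P being the
   law of X. *)
Definition optimal (f : vec R d -> R -> R) (g : vec R d -> R)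
    (X Xstar : {mfun O >-> pathSpace T x0}) : Prop :=
  forall A : set (pathSpace T x0), measurable A ->
    law Xstar A =
    \int[law X]_(x in A)
      (expeR (- work f g x) * (fine (partition_function f g X))^-1%:E).

Definition relative_error (f : vec R d -> R -> R) (g : vec R d -> R)
    (X Xu : {mfun O >-> pathSpace T x0}) : \bar R :=
  (fine (partition_function f g X))^-1%:E *
  sqrte 'V_P[fun w => fine (expeR (- work f g (Xu w))
                            * density (law X) (law Xu) (Xu w))].

End path_measures.

(* Main.v *)
(* Everything is computed under P along the uncontrolled process X. Write phi, phi*
   for the densities of the laws of X^u and X^{u*} with respect to that of X, and
   D = phi*/phi. Girsanov's formula reads phi = exp(M - A/2), with
   M = \int u(X_s, s) . dW_s and A = \int |u(X_s, s)|^2 ds, and similarly for phi*.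

   Since e^{-W} dP/dP^u = Z D under P^u, the relative error satisfies
   1 + r(u)^2 = E_{P^u}[D^2] = E_{P^{u*}}[D] =: c, and ln D <= D/c - 1 + ln c gives
   KL <= ln c.

   The second inequality does not use the dynamics of X^{u*}, nor a stopping time.
   For 0 < l < 1 and B = 1/2 \int |u* - u|^2(X_s, s) ds, completing the square shows
   that phi^l phi*^{1-l} e^{l(1-l)B} is the stochastic exponential of the integrand
   l u + (1-l) u*, whose expectation is at most 1. Dividing by phi*, this reads
   E_{P^{u*}}[exp(l((1-l) B - ln D))] <= 1; with e^t >= 1 + t and the bound on ln D
   it gives (1-l) E_{P^{u*}}[B] <= ln c, and one lets l tend to 0. *)
Require Import Defs.
From HB Require Import structures.
From mathcomp Require Import all_boot all_order all_algebra.
From mathcomp Require Import all_classical all_reals all_analysis.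
From mathcomp Require Import measurable_realfun ring lra.

Import Order.TTheory GRing.Theory Num.Theory.
Import numFieldNormedType.Exports.

Local Open Scope classical_set_scope.
Local Open Scope ring_scope.

Set Implicit Arguments.
Unset Strict Implicit.
Unset Printing Implicit Defensive.

(** * Gaussian exponentials and independence *)

Section normal_exponential.
Context (R : realType).
Local Open Scope ereal_scope.

(** The bound on the stochastic exponential has to come from the definition of the Ito integral as a
    limit in probability of integrals of simple processes, with independence of Brownian increments
    known on rectangles only. The expectation is therefore computed exactly for simple integrands,
    one increment and one coordinate at a time, and then passed to the limit. The limit turns the
    equality into an upper bound, which is all that the entropy argument uses. A direct computation
    of the relative entropy as the mean of B would need the stochastic integral of u* - u to have
    mean zero under the optimal measure; no such statement is proved here.

    Integrals of signed functions are avoided in the second inequality: the tangent bound on ln D is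
    added pointwise, and every term of negative sign is moved to the other side before
    integrating. *)

Lemma ge0_integral_normal_prob (s : R) (h : R -> \bar R) :
  (forall y, 0 <= h y) -> measurable_fun [set: R] h ->
  \int[normal_prob 0 s]_y h y =
  \int[lebesgue_measure]_y (h y * (normal_pdf 0 s y)%:E).
Proof.
move=> h0 mh.
have dom := normal_prob_dominates (0:R)%R s.
rewrite -(Radon_Nikodym_SigmaFinite.change_of_variables dom h0 measurableT mh).
apply: ae_eq_integral => //.
- apply: emeasurable_funM => //.
  exact: (measurable_int _ (Radon_Nikodym_SigmaFinite.f_integrable dom)).
- apply: emeasurable_funM => //; apply/measurable_EFinP.
  exact: measurable_normal_pdf.
apply: ae_eqe_mul2l; apply: integral_ae_eq => //.
- exact: Radon_Nikodym_SigmaFinite.f_integrable.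
- apply/measurable_EFinP; exact: measurable_normal_pdf.
- by move=> A _ mA; rewrite -Radon_Nikodym_SigmaFinite.f_integral.
Qed.

(** Completing the square: the exponential factor shifts the density of N(0, v) to that of N(g v,
    v), which integrates to 1. *)
Lemma integral_normal_expR (v g : R) : (0 < v)%R ->
  \int[normal_prob 0 (Num.sqrt v)]_y (expR (g * y - 2^-1 * g ^+ 2 * v))%:E = 1.
Proof.
move=> v0; rewrite ge0_integral_normal_prob; last 2 first.
- by move=> y; rewrite lee_fin expR_ge0.
- apply/measurable_EFinP/measurableT_comp => //.
  by apply: measurable_funB => //; exact: measurable_funM.
rewrite -(integral_normal_pdf (g * v) (Num.sqrt v)).
apply: eq_integral => y _; rewrite -EFinM; congr EFin.
have s0 : Num.sqrt v != 0%R by rewrite gt_eqF// sqrtr_gt0.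
rewrite !normal_pdfE//= mulrCA; congr (_ * _)%R.
rewrite /normal_fun -expRD sqr_sqrtr ?ltW//; congr expR.
by field; rewrite gt_eqF.
Qed.

End normal_exponential.

Section independent_exponential.
Context (R : realType) (dO : measure_display) (O : measurableType dO).
Variable P : probability O R.
Local Open Scope ereal_scope.

Section sub_sigma_algebra.
Variable G : set (set O).
Hypothesis sG : <<s G>> `<=` measurable.

(** By independence, the pair ([w], [Y w]), with [w] seen only through the events generated by [G],
    has a product law. Fubini then integrates [Y] first, with the [G]-measurable [psi] and [g]
    frozen, and the Gaussian exponential contributes the factor 1. *)
Lemma integral_indep_expR (Y : O -> R) (v : R) (psi g : O -> R) :
  (0 < v)%R -> measurable_fun setT Y ->
  (forall A B, <<s G>> A -> measurable B ->
    P (A `&` Y @^-1` B) = P A * normal_prob 0 (Num.sqrt v) B) ->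
  measurable_fun setT (psi : g_sigma_algebraType G -> R) ->
  measurable_fun setT (g : g_sigma_algebraType G -> R) ->
  (forall w, (0 <= psi w)%R) ->
  \int[P]_w (psi w * expR (g w * Y w - 2^-1 * g w ^+ 2 * v))%:E =
  \int[P]_w (psi w)%:E.
Proof.
move=> v0 mY indep mpsi mg psi0.
have mid : measurable_fun setT (id : O -> g_sigma_algebraType G).
  by move=> _ B mB; rewrite setTI; exact: sG.
pose idG : {mfun O >-> g_sigma_algebraType G} :=
  HB.pack (id : O -> g_sigma_algebraType G)
    (isMeasurableFun.Build _ _ _ _ _ mid).
pose Z : O -> (g_sigma_algebraType G * measurableTypeR R)%type := fun w => (w, Y w).
have mZ : measurable_fun setT Z by exact: measurable_fun_pair.
pose Zm : {mfun O >-> (g_sigma_algebraType G * measurableTypeR R)%type} :=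
  HB.pack Z (isMeasurableFun.Build _ _ _ _ _ mZ).
pose phi (z : g_sigma_algebraType G * measurableTypeR R) : \bar R :=
  (psi z.1 * expR (g z.1 * z.2 - 2^-1 * g z.1 ^+ 2 * v))%:E.
have phi0 z : 0 <= phi z by rewrite lee_fin mulr_ge0// expR_ge0.
have mg1 : measurable_fun setT
    (fun z : g_sigma_algebraType G * measurableTypeR R => g z.1).
  exact: measurableT_comp.
have mphi : measurable_fun setT phi.
  apply/measurable_EFinP/measurable_funM.
    exact: measurableT_comp.
  apply: measurableT_comp => //; apply: measurable_funB.
    exact: measurable_funM.
  apply: measurable_funM => //; apply: measurable_funM => //.
  exact: measurable_funX.
transitivity (\int[distribution P Zm]_z phi z).
  by rewrite ge0_integral_distribution.
pose m1 := distribution P idG.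
pose m2 := normal_prob (0 : R)%R (Num.sqrt v).
transitivity (\int[m1 \x m2]_z phi z).
  apply: eq_measure_integral => A mA _; apply: esym.
  exact: product_measure_unique.
rewrite fubini_tonelli1//.
pose psie (x : g_sigma_algebraType G) : \bar R := (psi x)%:E.
transitivity (\int[distribution P idG]_x psie x).
  apply: eq_integral => w _; rewrite /fubini_F /phi/=.
  under eq_integral do rewrite EFinM.
  rewrite ge0_integralZl//; first by rewrite integral_normal_expR ?mule1.
  apply/measurable_EFinP/measurableT_comp => //.
  by apply: measurable_funB => //; exact: measurable_funM.
  by rewrite lee_fin.
by rewrite ge0_integral_distribution//; apply/measurable_EFinP.
Qed.

End sub_sigma_algebra.
End independent_exponential.

(** * The Brownian filtration *)

Section path_measurability.
Context (R : realType).

Lemma measurable_coord m n (i : 'I_m) (j : 'I_n) :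
  measurable_fun [set: borelMx R m n] (fun M : borelMx R m n => M i j).
Proof.
apply: (measurability _ (RGenOInfty.measurableE R)).
move=> /= _ [_ [a ->]] <-; rewrite setTI; apply: sub_sigma_algebra.
have /continuousP := @coord_continuous R m n i j; apply.
exact: itv_open_ends_open.
Qed.

(** Evaluation at a time of [0, T] is continuous for the supremum norm; at any other time it is the
    constant [x0]. *)
Lemma measurable_ev d (T : R) (x0 : vec R d) (s : R) :
  measurable_fun setT (fun x : pathSpace T x0 => ev x s : borelMx R d 1).
Proof.
apply: (@measurability _ _ _ (borelMx R d 1) _ _ open) => //.
move=> /= _ [U oU <-]; rewrite setTI.
have [sT|sT] := boolP (s \in `[0, T]); last first.
  have [Ux0|Ux0] := pselect (U x0).
    rewrite [X in measurable X](_ : _ = setT)//; apply/seteqP; split => // x _ /=.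
    by rewrite /ev path_outside.
  rewrite [X in measurable X](_ : _ = set0)//; apply/seteqP; split => // x /=.
  by rewrite /ev path_outside.
apply: sub_sigma_algebra => x /= Ux.
have /nbhs_ballP[e e0 eU] : nbhs (ev x s) U by exact: open_nbhs_nbhs.
exists e => // x' xx'; apply: eU.
have := xx' s sT; rewrite distrC => h.
by rewrite -ball_normE.
Qed.

Lemma measurable_ev_coord d (T : R) (x0 : vec R d) (s : R) (i : 'I_d) :
  measurable_fun [set: pathSpace T x0] (fun x => ev x s i 0).
Proof.
apply: (@measurableT_comp _ _ _ _ _ (g_sigma_algebraType _)
  (fun M : borelMx R d 1 => M i 0) setT
  (fun x : pathSpace T x0 => (ev x s : borelMx R d 1))).
exact: measurable_coord.
exact: measurable_ev.
Qed.

End path_measurability.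

Section brownian_filtration.
Context (R : realType) (d : nat) (T : R).
Context (dO : measure_display) (O : measurableType dO) (P : probability O R).
Variable W : {mfun O >-> pathSpace T (0 : vec R d)}.

Lemma measurable_BM s : measurable_fun setT (fun w => ev (W w) s : borelMx R d 1).
Proof.
apply: (@measurableT_comp _ _ _ _ _ (borelMx R d 1)
  (fun x : pathSpace T (0 : vec R d) => ev x s : borelMx R d 1) setT W) => //.
exact: measurable_ev.
Qed.

Lemma measurable_BM_coord s i : measurable_fun setT (fun w => ev (W w) s i 0).
Proof.
apply: (@measurableT_comp _ _ _ _ _ R
  (fun x : pathSpace T (0 : vec R d) => ev x s i 0) setT W) => //.
exact: measurable_ev_coord.
Qed.

Lemma history_measurable t : history W t `<=` measurable.
Proof.
apply: smallest_sub; first exact: sigma_algebra_measurable.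
move=> _ [s [_ [B [mB ->]]]].
by rewrite -[X in measurable X]setTI; exact: measurable_BM.
Qed.

Lemma history_le s t : s <= t -> history W s `<=` history W t.
Proof.
move=> st; apply: sub_sigma_algebra2 => A [r [+ [B [mB ->]]]].
rewrite in_itv/= => /andP[r0 rs].
by exists r; split; [rewrite in_itv/= r0 (le_trans rs)|exists B].
Qed.

Lemma filtration_measurable t : filtration P W t `<=` measurable.
Proof. by move=> A []. Qed.

Lemma history_filtration t : history W t `<=` filtration P W t.
Proof.
move=> A hA; split; first exact: history_measurable hA.
by exists A => //; rewrite setDv setU0; exact: negligible_set0.
Qed.

Lemma filtration_le s t : s <= t -> filtration P W s `<=` filtration P W t.
Proof.
move=> st A [mA [B hB AB]]; split => //.
by exists B => //; exact: history_le hB.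
Qed.

Lemma filtration_sigma_algebra t : sigma_algebra setT (filtration P W t).
Proof.
split.
- apply: history_filtration; exact: sigma_algebra0.
- move=> A [mA [B hB AB]]; split; first exact: measurableD.
  exists (setT `\` B); first exact: sigma_algebraCD.
  by rewrite !setTD !setDE !setCK setUC (setIC (~` B)) (setIC (~` A)).
- move=> A fA; split; first by apply: bigcupT_measurable => n; case: (fA n).
  have hB n : exists B, history W t B /\
      P.-negligible ((A n `\` B) `|` (B `\` A n)).
    by case: (fA n) => _ [B hB AB]; exists B.
  have [B BP] := choice hB.
  exists (\bigcup_k B k); first by apply: sigma_algebra_bigcup => n; case: (BP n).
  apply: (@negligibleS _ _ _ _ (\bigcup_k ((A k `\` B k) `|` (B k `\` A k)))).
    move=> w [[[k _ Ak] nB]|[[k _ Bk] nA]]; exists k => //.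
      by left; split => // Bk; apply: nB; exists k.
    by right; split => // Ak; apply: nA; exists k.
  by apply: negligible_bigcup => k; case: (BP k).
Qed.

Lemma filtration_generated t : <<s filtration P W t >> = filtration P W t.
Proof. exact/sigma_algebra_id/filtration_sigma_algebra. Qed.

Lemma filtration_setT t : filtration P W t setT.
Proof.
rewrite -filtration_generated.
exact: (@measurableT _ (g_sigma_algebraType (filtration P W t))).
Qed.

Lemma measure_negligible_symdiff (A B : set O) : measurable A -> measurable B ->
  P.-negligible ((A `\` B) `|` (B `\` A)) -> P A = P B.
Proof.
move=> mA mB n; rewrite (measureDI P mA mB) (measureDI P mB mA) setIC.
rewrite (measure_negligible _ (negligibleS (@subsetUl _ _ _) n)); last exact: measurableD.
by rewrite (measure_negligible _ (negligibleS (@subsetUr _ _ _) n))//; exact: measurableD.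
Qed.

Hypothesis W_brownian : is_brownian P W.

(** Independence from the raw history extends to the augmented filtration, since replacing [A] by an
    event that differs from it by a null set changes neither side. *)
Lemma filtration_indep s t : 0 <= s -> s < t -> t <= T ->
  forall A, filtration P W s A ->
  forall B : 'I_d -> set R, (forall i, measurable (B i)) ->
    P (A `&` [set w | forall i, B i ((ev (W w) t - ev (W w) s) i 0)]) =
    (P A * \big[mule/1]_(i < d) normal_prob 0 (Num.sqrt (t - s)) (B i))%E.
Proof.
move=> s0 st tT A [mA [A' hA' AA']] B mB.
have mE : measurable [set w | forall i, B i ((ev (W w) t - ev (W w) s) i 0)].
  rewrite (_ : mkset _ = \bigcap_(i in [set: 'I_d])
      (fun w => ev (W w) t i 0 - ev (W w) s i 0) @^-1` B i).
    apply: fin_bigcap_measurable => // i _; rewrite -[X in measurable X]setTI.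
    by apply: measurable_funB => //; exact: measurable_BM_coord.
  apply/seteqP; split => w /= h i; last by have := h i I; rewrite !mxE.
  by move=> _; have := h i; rewrite !mxE.
have mA' := history_measurable hA'.
rewrite (measure_negligible_symdiff mA mA' AA').
rewrite -(W_brownian s0 st tT hA' mB).
apply: measure_negligible_symdiff; try exact: measurableI.
apply: negligibleS AA' => w [[[Aw Ew] nA']|[[Aw Ew] nA]]; [left|right];
 by split => // ?; apply: nA'|| apply: nA.
Qed.

End brownian_filtration.

Section brownian_exponential.
Context (R : realType) (d : nat) (T : R).
Context (dO : measure_display) (O : measurableType dO) (P : probability O R).
Variable W : {mfun O >-> pathSpace T (0 : vec R d)}.
Hypothesis W_brownian : is_brownian P W.
Variables (s t : R).
Hypotheses (s0 : 0 <= s) (st : s < t) (tT : t <= T).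

Let Y (i : 'I_d) (w : O) : R := ev (W w) t i 0 - ev (W w) s i 0.
Let nu := normal_prob (0 : R) (Num.sqrt (t - s)).

Let mY i : measurable_fun setT (Y i).
Proof. by apply: measurable_funB; exact: measurable_BM_coord. Qed.

(* The hypothesis on W only gives the probability of rectangles, so the
   coordinates of the increment are integrated out one at a time, each being
   independent of the events generated by the previous ones. *)
Definition increment_rect (j : nat) : set (set O) :=
  [set E | exists A (B : 'I_d -> set R), [/\ filtration P W s A,
     (forall i, measurable (B i)), (forall i : 'I_d, (j <= i)%N -> B i = setT) &
     E = A `&` \bigcap_(i in [set: 'I_d]) (Y i @^-1` B i)]].

Let indep A (B : 'I_d -> set R) : filtration P W s A ->
    (forall i, measurable (B i)) ->
  P (A `&` \bigcap_(i in [set: 'I_d]) (Y i @^-1` B i)) =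
    (P A * \big[mule/1]_(i < d) nu (B i))%E.
Proof.
move=> fA mB; rewrite -(filtration_indep W_brownian s0 st tT fA mB).
congr (P (A `&` _)); apply/seteqP; split => w /= h i.
  by rewrite !mxE; exact: h.
by move=> _; have := h i; rewrite !mxE.
Qed.

Let measurable_rect j : increment_rect j `<=` measurable.
Proof.
move=> _ [A [B [[mA _] mB _ ->]]]; apply: measurableI => //.
apply: fin_bigcap_measurable => // i _.
by rewrite -[X in measurable X]setTI; exact: mY.
Qed.

Let setI_closed_rect j : setI_closed (increment_rect j).
Proof.
move=> _ _ [A [B [fA mB Bj ->]]] [A' [B' [fA' mB' Bj' ->]]].
exists (A `&` A'), (fun i => B i `&` B' i); split.
- rewrite -filtration_generated.
  by apply: (@measurableI _ (g_sigma_algebraType (filtration P W s)));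
    apply: sub_sigma_algebra.
- by move=> i; exact: measurableI.
- by move=> i ji; rewrite Bj// Bj'// setTI.
- rewrite setIACA; congr (_ `&` _); apply/seteqP; split => w /=.
    by move=> [h h'] i _; split; [exact: h|exact: h'].
  by move=> h; split => i _; case: (h i I).
Qed.

(** Both sides, as functions of [A], are finite measures, so it suffices to compare them on the
    rectangles, which are stable under intersection. There coordinate [j] is unconstrained, and
    intersecting with the event on [Y j] only puts [C] into that free slot. *)
Let indep_rect (j : 'I_d) A C : <<s increment_rect j >> A -> measurable C ->
  P (A `&` Y j @^-1` C) = (P A * nu C)%E.
Proof.
move=> sA mC.
have mYC : measurable (Y j @^-1` C).
  by rewrite -[X in measurable X]setTI; exact: mY.
have nuC : nu C \is a fin_num by exact: fin_num_measure.
have nuC0 : 0 <= fine (nu C) by rewrite fine_ge0.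
pose m1 := mrestr P mYC.
pose m2 := mscale (NngNum nuC0) P.
suff : m1 A = m2 A by rewrite /m1 /m2 /mrestr /mscale/= fineK// muleC.
apply: (g_sigma_algebra_measure_unique (increment_rect j) _ (fun=> setT)) sA.
- exact: measurable_rect.
- move=> _; exists setT, (fun=> setT); split => //.
    exact: filtration_setT.
  by rewrite setTI bigcapT// => i _; rewrite preimage_setT.
- by apply/seteqP; split => // w _; exists 0%N.
- exact: setI_closed_rect.
- move=> _ [A' [B [fA mB Bj ->]]]; rewrite /= /mrestr /mscale/= fineK//.
  pose B' i := if i == j then C else B i.
  rewrite (_ : _ `&` _ = A' `&` \bigcap_(i in [set: 'I_d]) (Y i @^-1` B' i)).
    rewrite !indep//; last by move=> i; rewrite /B'; case: ifP.
    rewrite (bigD1 j)//= [X in (_ = _ * (_ * X))%E](bigD1 j)//=.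
    have nuT : nu setT = 1%E by exact: probability_setT.
    rewrite /B' eqxx Bj// nuT mul1e muleCA; congr (_ * (_ * _))%E.
    by apply: eq_bigr => i /negPf ->.
  rewrite -setIA; congr (_ `&` _); apply/seteqP; split => w /=.
    by move=> [h hC] i _; rewrite /B'; case: eqP => [->|_] //; exact: h.
  move=> h; split; last by have := h j I; rewrite /B' eqxx.
  move=> i _; have := h i I; rewrite /B'; case: eqP => // -> _.
  by rewrite Bj.
- by move=> k; rewrite -ge0_fin_numE//; exact: fin_num_measure.
Qed.

Let filtration_rect j : filtration P W s `<=` increment_rect j.
Proof.
move=> A fA; exists A, (fun=> setT); split => //.
by rewrite bigcapT ?setIT// => i _; rewrite preimage_setT.
Qed.

Let measurable_rect_Y j (i : 'I_d) : (i < j)%N ->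
  measurable_fun setT (Y i : g_sigma_algebraType (increment_rect j) -> R).
Proof.
move=> ij _ B mB; rewrite setTI; apply: sub_sigma_algebra.
exists setT, (fun k => if k == i then B else setT); split => //.
- exact: filtration_setT.
- by move=> k; case: ifP.
- by move=> k jk; case: eqP => // ki; rewrite -ki ltnNge jk in ij.
- rewrite setTI; apply/seteqP; split => w /=.
    by move=> h k _; case: eqP => // ->.
  by move=> h; have := h i I; rewrite eqxx.
Qed.

Let measurable_filtration_rect j (h : O -> R) :
  measurable_fun setT (h : g_sigma_algebraType (filtration P W s) -> R) ->
  measurable_fun setT (h : g_sigma_algebraType (increment_rect j) -> R).
Proof.
move=> mh _ B mB; have := mh measurableT B mB; rewrite !setTI.
by apply: sub_sigma_algebra2; exact: filtration_rect.
Qed.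

(** One step of the martingale property: given the past at time [s], the exponential of the
    increment has mean 1, hence drops out next to any nonnegative factor known at time [s]. *)
Lemma integral_exp_increment (F : O -> R) (g : 'I_d -> O -> R) :
  measurable_fun setT (F : g_sigma_algebraType (filtration P W s) -> R) ->
  (forall i, measurable_fun setT
    (g i : g_sigma_algebraType (filtration P W s) -> R)) ->
  (forall w, 0 <= F w) ->
  (\int[P]_w (F w * expR (\sum_(i < d)
     (g i w * Y i w - 2^-1 * g i w ^+ 2 * (t - s))))%:E =
   \int[P]_w (F w)%:E)%E.
Proof.
move=> mF mg F0.
pose h i w := g i w * Y i w - 2^-1 * g i w ^+ 2 * (t - s).
(* [psi j] keeps the factors of the first [j] coordinates. It is measurable for the events of
   [increment_rect j], of which coordinate [j] of the increment is independent. *)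
pose psi (j : nat) w := F w * expR (\sum_(i < d) if (i < j)%N then h i w else 0).
suff psiE j : (j <= d)%N -> (\int[P]_w (psi j w)%:E = \int[P]_w (F w)%:E)%E.
  transitivity (\int[P]_w (psi d w)%:E)%E; last exact: psiE.
  apply: eq_integral => w _; congr (_ * expR _)%:E.
  by apply: eq_bigr => i _; rewrite ltn_ord.
elim: j => [_|j IH jd].
  apply: eq_integral => w _; rewrite /psi big1 ?expR0 ?mulr1//.
rewrite -(IH (ltnW jd)); pose jo := Ordinal jd.
have mpsi : measurable_fun setT (psi j : g_sigma_algebraType (increment_rect j) -> R).
  apply: measurable_funM; first exact: measurable_filtration_rect.
  apply: measurableT_comp => //; apply: measurable_sum => i.
  have [ij|ij] := ltnP; last exact: measurable_cst.
  have mgi := @measurable_filtration_rect j _ (mg i).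
  apply: measurable_funB.
    by apply: measurable_funM => //; exact: measurable_rect_Y.
  by do 2 apply: measurable_funM => //; exact: measurable_funX.
have psi0 w : 0 <= psi j w by rewrite mulr_ge0// expR_ge0.
have sm : <<s increment_rect j >> `<=` measurable.
  by apply: smallest_sub; [exact: sigma_algebra_measurable|exact: measurable_rect].
rewrite -(@integral_indep_expR _ _ _ P _ sm (Y jo) (t - s) (psi j) (g jo))//.
- apply: eq_integral => w _; congr EFin; rewrite /psi -mulrA -expRD; congr (_ * expR _).
  rewrite [LHS](bigD1 jo)//= ltnSn addrC; congr (_ + _).
  rewrite [RHS](bigD1 jo)//= ltnn add0r; apply: eq_bigr => i ij.
  by rewrite ltnS leq_eqVlt -(inj_eq val_inj)/= in ij *; rewrite (negPf ij).
- by rewrite subr_gt0.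
- by move=> A B sA mB; exact: (@indep_rect jo).
- exact: measurable_filtration_rect.
Qed.

End brownian_exponential.

(** * Simple processes on a common subdivision *)

Section dot_coordinates.
Context (R : realType) (d : nat).
Implicit Types x y : vec R d.

Lemma dotE x y : dot x y = \sum_i x i 0 * y i 0.
Proof. by rewrite /dot mxE; apply: eq_bigr => i _; rewrite mxE. Qed.

Lemma sqnormE x : sqnorm x = \sum_i x i 0 ^+ 2.
Proof. by rewrite /sqnorm dotE; apply: eq_bigr => i _; rewrite expr2. Qed.

Lemma sqnorm_ge0 x : 0 <= sqnorm x.
Proof. by rewrite sqnormE sumr_ge0// => i _; rewrite sqr_ge0. Qed.

Lemma measurable_sqnorm d' (U : measurableType d') (D : set U) (h : U -> vec R d) :
  (forall i, measurable_fun D (fun z => h z i 0)) ->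
  measurable_fun D (fun z => sqnorm (h z)).
Proof.
move=> mh; under eq_fun do rewrite sqnormE.
by apply: measurable_sum => i; exact: measurable_funX.
Qed.

(** The free parameter [e] allows a small perturbation of [y] to change the squared norm by a factor
    close to 1, at the price of a large weight on the perturbation. *)
Lemma sqnorm_young (e : R) x y : 0 < e ->
  sqnorm x <= (1 + e) * sqnorm y + (1 + e^-1) * sqnorm (x - y).
Proof.
move=> e0; rewrite !sqnormE !mulr_sumr -big_split/=; apply: ler_sum => i _.
rewrite !mxE -subr_ge0.
rewrite (_ : _ - _ = e^-1 * (x i 0 - (1 + e) * y i 0) ^+ 2).
  by rewrite mulr_ge0 ?sqr_ge0// invr_ge0 ltW.
by field; rewrite gt_eqF.
Qed.

Lemma sqnorm_lin_comb_sub (a b : R) x y x' y' :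
  sqnorm (a *: x + b *: y - (a *: x' + b *: y')) <=
  2 * a ^+ 2 * sqnorm (x - x') + 2 * b ^+ 2 * sqnorm (y - y').
Proof.
rewrite !sqnormE !mulr_sumr -big_split/=; apply: ler_sum => i _.
rewrite !mxE -subr_ge0.
rewrite (_ : _ - _ = (a * (x i 0 - x' i 0) - b * (y i 0 - y' i 0)) ^+ 2).
  by rewrite sqr_ge0.
by ring.
Qed.

(** The square that is completed in the exponent: the convexity defect of the squared norm is the
    source of the term l (1 - l) B. *)
Lemma sqnorm_convex (l : R) x y :
  sqnorm (l *: x + (1 - l) *: y) + l * (1 - l) * sqnorm (y - x) =
  l * sqnorm x + (1 - l) * sqnorm y.
Proof.
rewrite !sqnormE !mulr_sumr -!big_split/=; apply: eq_bigr => i _.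
by rewrite !mxE; ring.
Qed.

Lemma measurable_lin_comb d' (U : measurableType d') (D : set U)
    (a b : R) (h k : U -> vec R d) :
  (forall i, measurable_fun D (fun z => h z i 0)) ->
  (forall i, measurable_fun D (fun z => k z i 0)) ->
  forall i, measurable_fun D (fun z => (a *: h z + b *: k z) i 0).
Proof.
move=> mh mk i.
rewrite (_ : (fun z => _) = (fun z => a * h z i 0 + b * k z i 0)).
  by apply: measurable_funD; apply: measurable_funM.
by apply/funext => z; rewrite !mxE.
Qed.

End dot_coordinates.

Section partition.
Context (R : realType) (T : R).

(** The last clause says that no point of [A] lies inside a cell. Cells may be degenerate, so
    repeated times are allowed. *)
Definition subdivision (A : set R) (t : nat -> R) (m : nat) : Prop :=
  [/\ {homo t : j k / (j <= k)%N >-> j <= k}, t 0%N = 0, t m = T &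
      forall a, A a -> forall k, a <= t k \/ t k.+1 <= a].

Lemma subdivision_exists (l : seq R) : 0 <= T ->
  (forall a, a \in l -> a \in `[0, T]) ->
  exists t m, subdivision [set` l] t m.
Proof.
move=> T0 lT; pose s := sort <=%R (0 :: l).
have ss : sorted <=%R s by apply: sort_sorted; exact: le_total.
have sE a : (a \in s) = (a \in 0 :: l) by rewrite mem_sort.
have sT a : a \in s -> 0 <= a <= T.
  by rewrite sE inE => /orP[/eqP ->|/lT]; rewrite ?lexx ?T0// in_itv.
(* The default value [T] closes the subdivision: [t] equals [T] from index [size s] on, whether or
   not [T] is in the list. *)
pose t k := nth T s k.
have tmono : {homo t : j k / (j <= k)%N >-> j <= k}.
  move=> j k jk; rewrite /t; have [ks|ks] := ltnP k (size s); last first.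
    rewrite [leRHS]nth_default//.
    have [js|js] := ltnP j (size s); last by rewrite nth_default.
    by have /andP[] := sT _ (mem_nth T js).
  by apply: (sorted_leq_nth le_trans lexx) => //; rewrite inE// (leq_ltn_trans jk).
exists t, (size s); split => //.
- have s0 : 0 \in s by rewrite sE inE eqxx.
  have sz : (0 < size s)%N by case: (s) s0.
  apply/eqP; rewrite eq_le; apply/andP; split.
    by rewrite -[leRHS](nth_index T s0); exact: (tmono 0%N).
  by have /andP[] := sT _ (mem_nth T sz).
- by rewrite /t nth_default.
- move=> a /= al k; have sa : a \in s by rewrite sE inE al orbT.
  have := nth_index T sa; rewrite -/(t _) => <-.
  by have [h|h] := leqP (index a s) k; [left|right]; exact: tmono.
Qed.

Context (A : set R) (t : nat -> R) (m : nat).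
Hypothesis tP : subdivision A t m.

Let tmono : {homo t : j k / (j <= k)%N >-> j <= k}. Proof. by case: tP. Qed.
Let t0 : t 0%N = 0. Proof. by case: tP. Qed.
Let tm : t m = T. Proof. by case: tP. Qed.
Let tA a k : A a -> a <= t k \/ t k.+1 <= a.
Proof. by case: tP => _ _ _ h /h. Qed.
Let tS k : t k <= t k.+1. Proof. exact: tmono. Qed.

Lemma subdivision_telescope (phi : R -> R) (a b : R) : A a -> A b ->
  0 <= a -> a <= b -> b <= T ->
  \sum_(k < m) (\1_(`]a, b]) (t k.+1) : R) * (phi (t k.+1) - phi (t k)) =
  phi b - phi a.
Proof.
move=> Aa Ab a0 ab bT.
(* Stopping the argument at [a] and [b] replaces the indicator: [psi] has the increments of [phi] on
   the cells within [a, b] and is constant on the others. *)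
pose psi x := phi (Num.min (Num.max x a) b).
transitivity (\sum_(0 <= k < m) (psi (t k.+1) - psi (t k))); last first.
  rewrite telescope_sumr// /psi tm t0 (max_l (le_trans ab bT)) (max_r a0).
  by rewrite (min_r bT) (min_l ab).
rewrite big_mkord; apply: eq_bigr => -[k km] _ /=; rewrite indicE.
have := tS k => tk; rewrite /psi.
have [ka|ka] := leP (t k.+1) a.
  rewrite (max_r (le_trans tk ka)) subrr.
  by rewrite mem_setE in_itv/= ltNge ka/= mul0r.
have ak : a <= t k by case: (tA k Aa) => // /(lt_le_trans ka); rewrite ltxx.
rewrite (max_l ak).
have [bk|bk] := tA k Ab.
  rewrite (min_r bk) (min_r (le_trans bk tk)) subrr mem_setE in_itv/= ka/=.
  have [kb|] := leP (t k.+1) b; rewrite ?mul0r// mul1r.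
  by rewrite (_ : t k.+1 = t k) ?subrr//; apply/eqP; rewrite eq_le tk (le_trans kb).
by rewrite (min_l bk) (min_l (le_trans tk bk)) mem_setE in_itv/= ka bk mul1r.
Qed.

(** Intervals and cells are open on the left, so the value on a cell is the one at its right
    endpoint. *)
Lemma indic_subdivision (a b s : R) k : A a -> A b -> t k < s -> s <= t k.+1 ->
  \1_(`]a, b]) s = \1_(`]a, b]) (t k.+1) :> R.
Proof.
move=> Aa Ab ks sk; rewrite !indicE !mem_setE !in_itv/=; congr ((_ && _)%:R).
  apply/idP/idP => [h|h]; first exact: lt_le_trans h sk.
  by case: (tA k Aa) => [h'|h']; [exact: le_lt_trans h' ks|rewrite ltNge h' in h].
apply/idP/idP => [h|h]; last exact: le_trans sk h.
by case: (tA k Ab) => // h'; have := lt_le_trans ks (le_trans h h'); rewrite ltxx.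
Qed.

Lemma integral_subdivision (q : R -> R) : 0 <= T ->
  measurable_fun `[0, T] q -> (forall s, 0 <= q s) ->
  (forall k s, t k < s -> s <= t k.+1 -> q s = q (t k.+1)) ->
  (\int[lebesgue_measure]_(s in `[0%R, T]) (q s)%:E =
   (\sum_(k < m) q (t k.+1) * (t k.+1 - t k))%:E)%E.
Proof.
move=> T0 mq q0 qc.
have mE : measurable_fun `[0, T] (EFin \o q) by exact/measurable_EFinP.
rewrite -integral_itv_obnd_cbnd; last first.
  by apply: measurable_funS mE => //; exact: subset_itv_oc_cc.
suff h n : (n <= m)%N -> (\int[lebesgue_measure]_(s in `]0%R, t n]) (q s)%:E =
   (\sum_(k < n) q (t k.+1) * (t k.+1 - t k))%:E)%E by rewrite -tm h.
elim: n => [_|n IH nm]; first by rewrite t0 set_itvoc0 integral_set0 big_ord0.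
have tn0 : 0 <= t n by rewrite -t0; exact: tmono.
have tnT : t n.+1 <= T by rewrite -tm; exact: tmono.
rewrite (@itv_bndbnd_setU _ _ (BRight 0) (BRight (t n)))//; last by rewrite bnd_simp.
rewrite ge0_integral_setU//=.
- rewrite IH ?(ltnW nm)// big_ord_recr/= EFinD; congr (_ + _)%E.
  rewrite (@eq_integral _ _ _ _ _ (cst (q (t n.+1))%:E)); last first.
    by move=> s; rewrite inE/= in_itv/= => /andP[h1 h2]; rewrite (qc n).
  rewrite integral_cst//= lebesgue_measure_itv/= lte_fin.
  case: ltP => h; first by rewrite -EFinB -EFinM.
  by rewrite mule0 (_ : t n.+1 = t n) ?subrr ?mulr0//; apply/eqP; rewrite eq_le h tS.
- rewrite -itv_bndbnd_setU ?bnd_simp//; apply: measurable_funS mE => //.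
  by move=> s /=; rewrite !in_itv/= => /andP[/ltW-> /= h]; exact: le_trans h tnT.
- by move=> s _; rewrite lee_fin.
- apply/disj_setPS => s [/=]; rewrite !in_itv/= => /andP[_ h] /andP[h' _].
  by have := le_lt_trans h h'; rewrite ltxx.
Qed.

End partition.

Section exponential_of_simple.
Context (R : realType) (d : nat) (T : R).
Context (dO : measure_display) (O : measurableType dO) (P : probability O R).
Variable W : {mfun O >-> pathSpace T (0 : vec R d)}.
Hypothesis W_brownian : is_brownian P W.

Lemma measurable_filtration_ev (r t : R) (i : 'I_d) : 0 <= r -> r <= t ->
  measurable_fun setT
    ((fun w => ev (W w) r i 0) : g_sigma_algebraType (filtration P W t) -> R).
Proof.
move=> r0 rt _ B mB; rewrite setTI; apply: sub_sigma_algebra.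
apply: history_filtration; apply: sub_sigma_algebra; exists r.
split; first by rewrite in_itv/= r0.
exists ((fun M : borelMx R d 1 => M i 0) @^-1` B); split => //.
by rewrite -[X in measurable X]setTI; exact: measurable_coord.
Qed.

Lemma measurable_filtration_le (s t : R) (h : O -> R) : s <= t ->
  measurable_fun setT (h : g_sigma_algebraType (filtration P W s) -> R) ->
  measurable_fun setT (h : g_sigma_algebraType (filtration P W t) -> R).
Proof.
move=> st mh _ B mB; have := mh measurableT B mB; rewrite !setTI.
by apply: sub_sigma_algebra2; exact: filtration_le.
Qed.

(** Induction on the number of steps: the exponential of the earlier steps is known at time [t m],
    so the last increment can be integrated out. *)
Lemma integral_exp_partition (t : nat -> R) (m : nat) (G : nat -> 'I_d -> O -> R) :
  0 <= t 0%N -> {homo t : j k / (j <= k)%N >-> j <= k} -> t m <= T ->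
  (forall k i, (k < m)%N -> measurable_fun setT
     (G k i : g_sigma_algebraType (filtration P W (t k)) -> R)) ->
  (\int[P]_w (expR (\sum_(k < m) \sum_(i < d)
    (G k i w * (ev (W w) (t k.+1) i 0 - ev (W w) (t k) i 0)
     - 2^-1 * G k i w ^+ 2 * (t k.+1 - t k))))%:E = 1)%E.
Proof.
move=> t0 tmono tT mG.
pose h k i w := G k i w * (ev (W w) (t k.+1) i 0 - ev (W w) (t k) i 0)
     - 2^-1 * G k i w ^+ 2 * (t k.+1 - t k).
elim: m => [|m IH] in tT mG *.
  under eq_integral do rewrite big_ord0 expR0.
  by rewrite integral_cst//= probability_setT mule1.
have tmT : t m <= T by exact: le_trans (tmono _ _ (leqnSn m)) tT.
rewrite -(IH tmT); last by move=> k i km; apply: mG; exact: ltnW.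
have tm0 : 0 <= t m by rewrite (le_trans t0)//; exact: tmono.
(* A degenerate step contributes nothing to the exponent, and the one-step identity asks for a
   positive length. *)
have := tmono _ _ (leqnSn m); rewrite le_eqVlt => /predU1P[tmm|tmm].
  apply: eq_integral => w _; rewrite big_ord_recr/= -tmm.
  by rewrite [X in _ + X]big1 ?addr0// => i _; rewrite !subrr !mulr0 subrr.
apply: (etrans _ (@integral_exp_increment _ _ _ _ _ P W W_brownian (t m) (t m.+1)
  tm0 tmm tT (fun w => expR (\sum_(k < m) \sum_(i < d) h k i w)) (G m) _ _ _)).
- by apply: eq_integral => w _; rewrite big_ord_recr/= expRD.
- apply: measurableT_comp => //; apply: measurable_sum => -[k km] /=.
  apply: measurable_sum => i.
  have mGk : measurable_fun setT
      (G k i : g_sigma_algebraType (filtration P W (t m)) -> R).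
    apply: (@measurable_filtration_le (t k)); first exact/tmono/ltnW.
    by apply: mG; exact: ltnW.
  have tk0 : 0 <= t k by rewrite (le_trans t0)//; exact: tmono.
  apply: measurable_funB; last first.
    by do 2 apply: measurable_funM => //; exact: measurable_funX.
  apply: measurable_funM => //; apply: measurable_funB.
    apply: measurable_filtration_ev; last exact: tmono.
    by rewrite (le_trans t0)//; exact: tmono.
  by apply: measurable_filtration_ev => //; exact/tmono/ltnW.
- by move=> i; exact: mG.
- by move=> w; rewrite expR_ge0.
Qed.

Let times (S : simple_process P W) := [seq sp_time S j | j <- iota 0 (sp_size S).+1].

Let times_in (S : simple_process P W) a : a \in times S -> a \in `[0, T].
Proof.
move=> /mapP[j]; rewrite mem_iota add0n ltnS => /andP[_ jS] ->.
rewrite in_itv/= (le_trans (sp_time_ge0 S)) ?(le_trans _ (sp_time_leT S))//.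
  exact: sp_time_nd.
exact: sp_time_nd.
Qed.

Let mem_times (S : simple_process P W) j : (j <= sp_size S)%N ->
  sp_time S j \in times S.
Proof. by move=> jS; apply/mapP; exists j => //; rewrite mem_iota. Qed.

Lemma sp_evalE (S : simple_process P W) s w i : sp_eval S s w i 0 =
  \sum_(j < sp_size S) (\1_(`]sp_time S j, sp_time S j.+1]) s : R) * sp_val S j w i 0.
Proof. by rewrite /sp_eval summxE; apply: eq_bigr => j _; rewrite mxE. Qed.

Section refinement.
Variables (A : set R) (t : nat -> R) (m : nat).
Hypothesis tP : subdivision T A t m.
Variable S : simple_process P W.
Hypothesis SA : forall j, (j <= sp_size S)%N -> A (sp_time S j).

Lemma sp_eval_subdivision k s w : t k < s -> s <= t k.+1 ->
  sp_eval S s w = sp_eval S (t k.+1) w.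
Proof.
move=> ks sk; apply: eq_bigr => j _; congr (_ *: _).
by apply: (indic_subdivision tP) ks sk; apply: SA; [exact: ltnW|].
Qed.

(** The value is read at the right end of the cell but is known at its left end: an interval of [S]
    that starts before [t k.+1] starts no later than [t k], since its endpoints do not fall inside a
    cell. *)
Lemma sp_eval_adapted k i : (k < m)%N -> measurable_fun setT
  ((fun w => sp_eval S (t k.+1) w i 0)
    : g_sigma_algebraType (filtration P W (t k)) -> R).
Proof.
move=> km; under eq_fun do rewrite sp_evalE.
apply: measurable_sum => j; rewrite indicE mem_setE in_itv/=.
have [h|_] := ltP (sp_time S j) (t k.+1); last first.
  by under eq_fun do rewrite mul0r; exact: measurable_cst.
apply: measurable_funM => //; apply: (@measurable_filtration_le (sp_time S j)).
  have [_ _ _ tA] := tP; case: (tA _ (SA (ltnW (ltn_ord j))) k) => // h'.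
  by have := lt_le_trans h h'; rewrite ltxx.
move=> _ B mB; rewrite setTI; apply: sub_sigma_algebra.
apply: (sp_adapted (ltn_ord j) (B := (fun M : borelMx R d 1 => M i 0) @^-1` B)).
by rewrite -[X in measurable X]setTI; exact: measurable_coord.
Qed.

Lemma sp_int_subdivision w : sp_int S T w =
  \sum_(k < m) \sum_(i < d)
    sp_eval S (t k.+1) w i 0 * (ev (W w) (t k.+1) i 0 - ev (W w) (t k) i 0).
Proof.
rewrite /sp_int exchange_big/=.
under eq_bigr do rewrite dotE.
rewrite exchange_big/=; apply: eq_bigr => i _.
under [RHS]eq_bigr do rewrite sp_evalE mulr_suml.
rewrite exchange_big/=; apply: eq_bigr => -[j jS] _ /=.
have inT k : (k <= sp_size S)%N -> sp_time S k <= T.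
  by move=> kS; rewrite (le_trans _ (sp_time_leT S))//; exact: sp_time_nd.
rewrite !min_r ?inT//; last exact: ltnW.
rewrite !mxE -(@subdivision_telescope _ _ _ _ _ tP (fun x => ev (W w) x i 0)
  (sp_time S j) (sp_time S j.+1))//.
- by rewrite mulr_sumr; apply: eq_bigr => k _; rewrite mulrCA mulrA.
- by apply: SA; exact: ltnW.
- exact: SA.
- by rewrite (le_trans (sp_time_ge0 S))//; exact: sp_time_nd.
- exact: sp_time_nd.
- exact: inT.
Qed.

End refinement.

Lemma measurable_sp_eval (S : simple_process P W) w i D :
  measurable_fun D (fun s => sp_eval S s w i 0).
Proof.
under eq_fun do rewrite sp_evalE; apply: measurable_sum => j.
by apply: measurable_funM => //; apply: measurable_indic.
Qed.

Lemma common_subdivision (S S' : simple_process P W) : 0 < T ->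
  exists A t m, [/\ subdivision T A t m,
    forall j, (j <= sp_size S)%N -> A (sp_time S j) &
    forall j, (j <= sp_size S')%N -> A (sp_time S' j)].
Proof.
move=> T_gt0.
have [|t [m tP]] := @subdivision_exists _ T (times S ++ times S') (ltW T_gt0).
  by move=> x; rewrite mem_cat => /orP[] /times_in.
exists [set` times S ++ times S'], t, m; split => // j jS.
- suff : sp_time S j \in times S ++ times S' by [].
  by rewrite mem_cat mem_times.
- suff : sp_time S' j \in times S ++ times S' by [].
  by rewrite mem_cat orbC mem_times.
Qed.

Section common_refinement.
Variables (A : set R) (t : nat -> R) (m : nat).
Hypothesis tP : subdivision T A t m.
Variables S S' : simple_process P W.
Hypothesis SA : forall j, (j <= sp_size S)%N -> A (sp_time S j).
Hypothesis SA' : forall j, (j <= sp_size S')%N -> A (sp_time S' j).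

Lemma integral_sqnorm_subdivision (T_gt0 : 0 < T) (a b : R) w :
  (\int[lebesgue_measure]_(s in `[0%R, T])
     (sqnorm (a *: sp_eval S s w + b *: sp_eval S' s w)%R)%:E =
   (\sum_(k < m) sqnorm (a *: sp_eval S (t k.+1) w + b *: sp_eval S' (t k.+1) w)
      * (t k.+1 - t k))%:E)%E.
Proof.
rewrite (integral_subdivision tP (ltW T_gt0))//.
- apply: (@measurable_sqnorm _ _ _ _ _
    (fun s => a *: sp_eval S s w + b *: sp_eval S' s w)).
  by apply: measurable_lin_comb => i; exact: measurable_sp_eval.
- by move=> s; exact: sqnorm_ge0.
- move=> k s ks sk; rewrite (sp_eval_subdivision tP SA _ ks sk).
  by rewrite (sp_eval_subdivision tP SA' _ ks sk).
Qed.

End common_refinement.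

Lemma integral_sqnorm_simple_fin_num (T_gt0 : 0 < T) (S S' : simple_process P W)
    (a b : R) w :
  (\int[lebesgue_measure]_(s in `[0%R, T])
     (sqnorm (a *: sp_eval S s w + b *: sp_eval S' s w)%R)%:E)%E \is a fin_num.
Proof.
have [A [t [m [tP SA SA']]]] := common_subdivision S S' T_gt0.
by rewrite (integral_sqnorm_subdivision tP SA SA').
Qed.

(** On a common subdivision the combination of the two processes is a step integrand with adapted
    values, to which the exponential along a partition applies directly. *)
Lemma integral_exp_simple (T_gt0 : 0 < T) (S S' : simple_process P W) (a b : R) :
  (\int[P]_w (expR (a * sp_int S T w + b * sp_int S' T w
     - 2^-1 * fine (\int[lebesgue_measure]_(s in `[0%R, T])
        (sqnorm (a *: sp_eval S s w + b *: sp_eval S' s w)%R)%:E)))%:E = 1)%E.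
Proof.
have [A [t [m [tP SA SA']]]] := common_subdivision S S' T_gt0.
pose G k i w := a * sp_eval S (t k.+1) w i 0 + b * sp_eval S' (t k.+1) w i 0.
have [tmono t0 tm _] := tP.
have G1 := @integral_exp_partition t m G _ tmono.
rewrite -[RHS]G1 ?t0 ?tm//; last first.
  move=> k i km; apply: measurable_funD; apply: measurable_funM => //.
    exact: (sp_eval_adapted tP SA).
  exact: (sp_eval_adapted tP SA').
apply: eq_integral => w _; congr (expR _)%:E.
rewrite (sp_int_subdivision tP SA) (sp_int_subdivision tP SA').
rewrite (integral_sqnorm_subdivision tP SA SA')//.
rewrite /= !mulr_sumr -big_split/= -sumrB; apply: eq_bigr => k _.
rewrite sqnormE mulr_suml !mulr_sumr -big_split -sumrB; apply: eq_bigr => i _.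
by rewrite /= !mxE /G; ring.
Qed.

End exponential_of_simple.

(** * Limits of integrals and convergence in probability *)

Section ge0_integral_real.
Context (R : realType) (dT : measure_display) (E : measurableType dT).
Variables (mu : {measure set E -> \bar R}) (D : set E).
Hypothesis mD : measurable D.
Implicit Types f g h : E -> R.

Lemma ge0_integral_lin (a b : R) g h : 0 <= a -> 0 <= b ->
  measurable_fun D g -> measurable_fun D h ->
  (forall x, D x -> 0 <= g x) -> (forall x, D x -> 0 <= h x) ->
  (\int[mu]_(x in D) (a * g x + b * h x)%:E =
   a%:E * \int[mu]_(x in D) (g x)%:E + b%:E * \int[mu]_(x in D) (h x)%:E)%E.
Proof.
move=> a0 b0 mg mh g0 h0.
under eq_integral do rewrite EFinD !EFinM.
rewrite ge0_integralD//; last 4 first.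
- by move=> x Dx; rewrite mule_ge0 ?lee_fin ?g0.
- by apply/measurable_EFinP/measurable_funM.
- by move=> x Dx; rewrite mule_ge0 ?lee_fin ?h0.
- by apply/measurable_EFinP/measurable_funM.
by congr (_ + _)%E; rewrite ge0_integralZl_EFin//; exact/measurable_EFinP.
Qed.

Lemma ge0_integral_le_lin (a b : R) f g h : 0 <= a -> 0 <= b ->
  measurable_fun D f -> measurable_fun D g -> measurable_fun D h ->
  (forall x, D x -> 0 <= f x) ->
  (forall x, D x -> 0 <= g x) -> (forall x, D x -> 0 <= h x) ->
  (forall x, D x -> f x <= a * g x + b * h x) ->
  (\int[mu]_(x in D) (f x)%:E <=
   a%:E * \int[mu]_(x in D) (g x)%:E + b%:E * \int[mu]_(x in D) (h x)%:E)%E.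
Proof.
move=> a0 b0 mf mg mh f0 g0 h0 fgh; rewrite -ge0_integral_lin//.
apply: ge0_le_integral => //.
- exact/measurable_EFinP.
- by apply/measurable_EFinP/measurable_funD; exact: measurable_funM.
Qed.

End ge0_integral_real.

Section fatou_bound.
Context (R : realType) (dT : measure_display) (E : measurableType dT).
Variable mu : {measure set E -> \bar R}.

(** Fatou's lemma with the limit known almost everywhere: the lower limit [Li] is defined and
    measurable everywhere, and [V] agrees with it off a null set. *)
Lemma integral_le_ae_cvg (L : nat -> E -> R) (V : E -> R) (c : \bar R) :
  (forall n, measurable_fun setT (L n)) -> measurable_fun setT V ->
  (forall n x, 0 <= L n x) -> (forall x, 0 <= V x) ->
  (forall n, (\int[mu]_x (L n x)%:E <= c)%E) ->
  {ae mu, forall x, L n x @[n --> \oo] --> V x} ->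
  (\int[mu]_x (V x)%:E <= c)%E.
Proof.
move=> mL mV L0 V0 Lc LV.
have mLE n : measurable_fun setT (EFin \o L n) by exact/measurable_EFinP.
pose Li x := limn_einf (fun n => (L n x)%:E).
have Li0 x : (0 <= Li x)%E.
  rewrite /Li limn_einf_lim; apply: lime_ge; first exact: is_cvg_einfs.
  by apply: nearW => n; apply: le_ereal_inf_tmp => _ [m _ <-]; rewrite lee_fin.
have mLi : measurable_fun setT Li.
  rewrite /Li /limn_einf; apply: measurableT_comp => //.
  apply: (measurable_fun_limn_esup (f := fun n x => (- (L n x)%:E)%E)) => n.
  by apply: measurableT_comp => //; exact: mLE.
rewrite (@ge0_ae_eq_integral _ _ _ mu setT _ Li)//; last 3 first.
- exact/measurable_EFinP.
- by move=> x _; rewrite lee_fin.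
- apply: filterS LV => x LV _; apply/esym.
  have /cvg_limn_einf_sup[] : (L n x)%:E @[n --> \oo] --> (V x)%:E.
    by apply: cvg_EFin; [exact: nearW|exact: LV].
  by [].
apply: le_trans (fatou _ measurableT mLE _) _; first by move=> n x _; rewrite lee_fin.
rewrite limn_einf_lim; apply: lime_le; first exact: is_cvg_einfs.
apply: nearW => n; apply: le_trans (Lc n); apply: ereal_inf_lbound.
by exists n => //=.
Qed.

End fatou_bound.

Section convergence_in_probability.
Context (R : realType) (dO : measure_display) (O : measurableType dO).
Variable P : probability O R.
Local Open Scope ereal_scope.
Implicit Types Y Z : nat -> O -> \bar R.

Let measurable_ge Y n (e : R) : measurable_fun setT (Y n) ->
  measurable [set w | e%:E <= `|Y n w|].
Proof.
move=> mY; rewrite -[X in measurable X]setTI.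
by apply: emeasurable_fun_c_infty => //; exact: measurableT_comp.
Qed.

Lemma cvg0_in_probability_add Y Z :
  (forall n, measurable_fun setT (Y n)) -> (forall n, measurable_fun setT (Z n)) ->
  cvg0_in_probability P Y -> cvg0_in_probability P Z ->
  cvg0_in_probability P (fun n w => `|Y n w| + `|Z n w|).
Proof.
move=> mY mZ Y0 Z0 e e0; have e20 : (0 < e / 2)%R by rewrite divr_gt0.
have mYZ n : measurable_fun setT (fun w => `|Y n w| + `|Z n w|).
  by apply: emeasurable_funD; exact: measurableT_comp.
have YZ0 : P [set w | (e / 2)%:E <= `|Y n w|] + P [set w | (e / 2)%:E <= `|Z n w|]
    @[n --> \oo] --> 0.
  by rewrite -[X in _ --> X]adde0; apply: cvgeD => //; [exact: Y0|exact: Z0].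
apply: (squeeze_cvge _ (cvg_cst 0) YZ0); apply: nearW => n; rewrite measure_ge0/=.
apply: le_trans (measureU2 _ _ _); try exact: measurable_ge.
apply: le_measure; rewrite ?inE.
- by apply: (@measurable_ge (fun n w => `|Y n w| + `|Z n w|)).
- by apply: measurableU; exact: measurable_ge.
move=> w /= h; have [h1|h1] := leP (e / 2)%:E `|Y n w|; first by left.
right; rewrite leNgt; apply/negP => h2; move: h; apply/negP; rewrite -ltNge.
by rewrite gee0_abs ?adde_ge0// [X in X%:E](splitr e) EFinD lteD.
Qed.

(** Borel-Cantelli: the indices are chosen so that the value exceeds 2^-(k+1) with probability at
    most 2^-(k+1), which is summable. The chosen indices are not claimed to increase. *)
Lemma cvg0_in_probability_subseq Y : (forall n, measurable_fun setT (Y n)) ->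
  cvg0_in_probability P Y -> exists sub : nat -> nat,
    {ae P, forall w, `|Y (sub k) w| @[k --> \oo] --> 0}.
Proof.
move=> mY Y0; pose e (k : nat) : R := (1 / (2 ^ k.+1)%:R)%R.
have e0 k : (0 < e k)%R by rewrite divr_gt0// ltr0n expn_gt0.
have ex k : exists n, P [set w | (e k)%:E <= `|Y n w|] <= (e k)%:E.
  have := Y0 _ (e0 k) => /fine_cvgP[fin /cvgrPdist_le/(_ _ (e0 k)) near].
  have [n _ /(_ n (leqnn n))[nfin]] := filterI fin near.
  rewrite /= sub0r normrN ger0_norm ?fine_ge0// => h.
  by exists n; rewrite -(fineK nfin) lee_fin.
have [sub subP] := choice ex; exists sub.
pose F k := [set w | (e k)%:E <= `|Y (sub k) w|].
have mF k : measurable (F k) by exact: measurable_ge.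
exists (lim_sup_set F); split.
- by apply: bigcap_measurable => // k _; apply: bigcup_measurable.
- apply: lim_sup_set_cvg0 => //.
  apply: (@le_lt_trans _ _ (\sum_(k <oo) (e k)%:E)).
    by apply: lee_nneseries => // k _; exact: subP.
  by apply: le_lt_trans (epsilon_trick0 xpredT ler01) _; exact: ltry.
move=> w /= Yw n _; apply: contrapT => Fw; apply: Yw.
have h k : (n <= k)%N -> 0 <= `|Y (sub k) w| <= (e k)%:E.
  move=> nk; rewrite abse_ge0/= leNgt; apply/negP => h; apply: Fw.
  by exists k => //; exact: ltW.
apply: (squeeze_cvge (f := cst 0) (h := fun k => (e k)%:E)).
- by exists n => // k /= /h.
- exact: cvg_cst.
- apply: cvg_EFin; first exact: nearW.
  rewrite (_ : e = geometric (2^-1)%R (2^-1)%R).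
    by apply: cvg_geometric; rewrite ger0_norm// invf_lt1// ltr1n.
  apply/funext => k; rewrite /e /= div1r natrX exprSr invfM mulrC exprVn.
  by rewrite mulrC.
Qed.

End convergence_in_probability.

Section time_integral.
Context (R : realType) (dO : measure_display) (O : measurableType dO) (T : R).

Lemma measurable_time_integral (q : R * O -> R) : (forall z, 0 <= q z) ->
  measurable_fun (`[0, T]%classic `*` [set: O]) q ->
  measurable_fun [set: O]
    (fun w => \int[lebesgue_measure]_(s in `[0%R, T]) (q (s, w))%:E)%E.
Proof.
move=> q0 mq; have mD : measurable (`[0, T]%classic `*` [set: O]) by exact: measurableX.
pose f := (EFin \o q) \_ (`[0, T]%classic `*` [set: O]).
have mf : measurable_fun setT f.
  by apply/(measurable_restrictT _ mD); exact/measurable_EFinP.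
have f0 z : (0 <= f z)%E by apply: erestrict_ge0 => *; rewrite lee_fin.
have := @measurable_fun_fubini_tonelli_G _ _ _ _ R lebesgue_measure f mf f0.
apply: eq_measurable_fun => w _; rewrite /fubini_G [RHS]integral_mkcond.
apply: eq_integral => s _; rewrite /f !patchE.
by rewrite (_ : ((s, w) \in _) = (s \in `[0, T]%classic))// in_setX in_setT andbT.
Qed.

End time_integral.

(** * Stochastic exponentials of Ito integrals *)

Section ito_exponential.
Context (R : realType) (d : nat) (T : R).
Context (dO : measure_display) (O : measurableType dO) (P : probability O R).
Variable W : {mfun O >-> pathSpace T (0 : vec R d)}.
Hypothesis W_brownian : is_brownian P W.
Hypothesis T_gt0 : 0 < T.

(** Along a sample path of an integrand, this is the quadratic variation at time [T] of its Ito
    integral; it takes values in the extended reals because finiteness holds only almost surely. *)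
Definition l2norm2 (x : R -> vec R d) : \bar R :=
  (\int[lebesgue_measure]_(s in `[0%R, T]) (sqnorm (x s))%:E)%E.

Definition jointly_measurable (H : R -> O -> vec R d) : Prop :=
  forall i, measurable_fun (`[0, T]%classic `*` [set: O])
    (fun z : R * O => H z.1 z.2 i 0).

Lemma l2norm2_ge0 x : (0 <= l2norm2 x)%E.
Proof. by apply: integral_ge0 => s _; rewrite lee_fin sqnorm_ge0. Qed.

Lemma jointly_measurable_lin_comb a b H K :
  jointly_measurable H -> jointly_measurable K ->
  jointly_measurable (fun s w => a *: H s w + b *: K s w).
Proof.
move=> mH mK; exact: (@measurable_lin_comb _ _ _ _ _ a b
  (fun z => H z.1 z.2) (fun z => K z.1 z.2)).
Qed.

Lemma jointly_measurable_sub H K :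
  jointly_measurable H -> jointly_measurable K ->
  jointly_measurable (fun s w => H s w - K s w).
Proof.
move=> mH mK i; have := jointly_measurable_lin_comb 1 (-1) mH mK i.
by apply: eq_measurable_fun => z _; rewrite scale1r scaleN1r.
Qed.

Lemma measurable_section H w i : jointly_measurable H ->
  measurable_fun `[0, T] (fun s => H s w i 0).
Proof.
move=> mH; apply: (@measurable_comp _ _ _ _ _ _ (`[0, T]%classic `*` [set: O])
  (fun z : R * O => H z.1 z.2 i 0) `[0, T]%classic (fun s => (s, w))) => //.
- exact: measurableX.
- by move=> _ [s sT <-].
- by apply: measurable_funTS; exact: pair2_measurable.
Qed.

Lemma measurable_sqnorm_section H w : jointly_measurable H ->
  measurable_fun `[0, T] (fun s => sqnorm (H s w)).
Proof.
move=> mH; apply: (@measurable_sqnorm _ _ _ _ _ (fun s => H s w)) => i.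
exact: measurable_section.
Qed.

Lemma measurable_l2norm2 H : jointly_measurable H ->
  measurable_fun [set: O] (fun w => l2norm2 (H ^~ w)).
Proof.
move=> mH; apply: (@measurable_time_integral _ _ _ _
  (fun z : R * O => sqnorm (H z.1 z.2))) => [z|]; first exact: sqnorm_ge0.
exact: (@measurable_sqnorm _ _ _ _ _ (fun z : R * O => H z.1 z.2)).
Qed.

Lemma measurable_fine_l2norm2 H : jointly_measurable H ->
  measurable_fun [set: O] (fun w => fine (l2norm2 (H ^~ w))).
Proof.
move=> /measurable_l2norm2 mH.
exact: (measurableT_comp (fine_measurable measurableT) mH).
Qed.

Lemma l2norm2_le_lin (a b : R) H K L w : 0 <= a -> 0 <= b ->
  jointly_measurable H -> jointly_measurable K -> jointly_measurable L ->
  (forall s, sqnorm (H s w) <= a * sqnorm (K s w) + b * sqnorm (L s w)) ->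
  (l2norm2 (H ^~ w) <= a%:E * l2norm2 (K ^~ w) + b%:E * l2norm2 (L ^~ w))%E.
Proof.
move=> a0 b0 mH mK mL HKL; apply: ge0_integral_le_lin => //;
  by [exact: measurable_sqnorm_section|move=> s _; exact: sqnorm_ge0].
Qed.

Section simple.
Variable S : simple_process P W.

Lemma measurable_sp_val (k : nat) i : (k < sp_size S)%N ->
  measurable_fun setT (fun w => sp_val S k w i 0).
Proof.
move=> kS _ B mB; rewrite setTI; apply: filtration_measurable.
apply: (sp_adapted kS (B := (fun M : borelMx R d 1 => M i 0) @^-1` B)).
by rewrite -[X in measurable X]setTI; exact: measurable_coord.
Qed.

Lemma jointly_measurable_simple : jointly_measurable (fun s w => sp_eval S s w).
Proof.
move=> i; apply: measurable_funTS => /=.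
rewrite (_ : (fun z => _) = (fun z : R * O => \sum_(j < sp_size S)
   (\1_(`]sp_time S j, sp_time S j.+1]) z.1 : R) * sp_val S j z.2 i 0)); last first.
  by apply/funext => z; rewrite sp_evalE.
apply: measurable_sum => j; apply: measurable_funM.
  by apply: measurableT_comp => //; exact: measurable_indic.
exact: (measurableT_comp (measurable_sp_val i (ltn_ord j))).
Qed.

Lemma measurable_sp_int t : measurable_fun setT (fun w => sp_int S t w).
Proof.
apply: measurable_sum => j; under eq_fun do rewrite dotE.
apply: measurable_sum => i; apply: measurable_funM; first exact: measurable_sp_val.
rewrite (_ : (fun w => _) = (fun w =>
  ev (W w) (Num.min t (sp_time S j.+1)) i 0 - ev (W w) (Num.min t (sp_time S j)) i 0)).
  by apply: measurable_funB; exact: measurable_BM_coord.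
by apply/funext => w; rewrite !mxE.
Qed.

End simple.

Lemma l2norm2_simple_fin_num (S S' : simple_process P W) a b w :
  l2norm2 (fun s => a *: sp_eval S s w + b *: sp_eval S' s w) \is a fin_num.
Proof. exact: integral_sqnorm_simple_fin_num. Qed.

Lemma l2norm2_simple_fin_num1 (S : simple_process P W) w :
  l2norm2 (fun s => sp_eval S s w) \is a fin_num.
Proof.
have := l2norm2_simple_fin_num S S 1 0 w.
rewrite (_ : (fun s => _) = (fun s => sp_eval S s w))//.
by apply/funext => s; rewrite scale1r scale0r addr0.
Qed.

Lemma ito_jointly_measurable H I : is_ito_integral P W H I -> jointly_measurable H.
Proof.
case=> mH _ _ _ i.
exact: (@measurableT_comp _ _ _ _ _ R (fun M : borelMx R d 1 => M i 0) _ _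
  (measurable_coord i 0) mH).
Qed.

(* A single sequence, so that one subsequence serves both approximations. *)
Definition ito_error (H : R -> O -> vec R d) (I : R -> O -> R)
    (S : nat -> simple_process P W)    (n : nat) (w : O) : \bar R :=
  (`|l2norm2 (fun s => sp_eval (S n) s w - H s w)%R|
   + `|(sp_int (S n) T w - I T w)%:E|)%E.

Lemma ito_error_cvg H I : is_ito_integral P W H I -> exists S,
  (forall n, measurable_fun setT (ito_error H I S n)) /\
  cvg0_in_probability P (ito_error H I S).
Proof.
move=> HI; have mH := ito_jointly_measurable HI.
case: HI => _ mI _ [S [S1 S2]]; exists S.
have TT : T \in `[0, T] by rewrite in_itv/= lexx ltW.
have m1 n : measurable_fun setT (fun w => l2norm2 (fun s => sp_eval (S n) s w - H s w)).
  by apply: measurable_l2norm2; apply: jointly_measurable_sub => //;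
    exact: jointly_measurable_simple.
have m2 n : measurable_fun setT (fun w => (sp_int (S n) T w - I T w)%:E).
  by apply/measurable_EFinP/measurable_funB; [exact: measurable_sp_int|exact: mI].
split; first by move=> n; apply: emeasurable_funD; exact: measurableT_comp.
by apply: (cvg0_in_probability_add m1 m2) => //; exact: S2.
Qed.

Let cvg0_addl (f g : nat -> \bar R) :
  (`| `|f n| + `|g n| | @[n --> \oo] --> 0 -> `|f n| @[n --> \oo] --> 0)%E.
Proof.
move=> fg; apply: (squeeze_cvge _ (cvg_cst 0%E) fg); apply: nearW => n.
by rewrite abse_ge0/= [X in (_ <= X)%E]gee0_abs ?adde_ge0// leeDl.
Qed.

Let cvg0_addr (f g : nat -> \bar R) :
  (`| `|f n| + `|g n| | @[n --> \oo] --> 0 -> `|g n| @[n --> \oo] --> 0)%E.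
Proof. by under eq_fun do rewrite addeC; exact: cvg0_addl. Qed.

Let ito_error_split H I S (sub : nat -> nat) w :
  (`|ito_error H I S (sub n) w| @[n --> \oo] --> 0)%E ->
  l2norm2 (fun s => sp_eval (S (sub n)) s w - H s w) @[n --> \oo] --> 0%E /\
  sp_int (S (sub n)) T w @[n --> \oo] --> I T w.
Proof.
move=> h; split.
  have := cvg0_addl h; apply: cvg_trans; apply: near_eq_cvg; apply: nearW => n.
  by rewrite gee0_abs// l2norm2_ge0.
have /fine_cvg h2 := cvg0_addr h.
apply: cvg_sub0 (cvg_cst (I T w)).
apply/norm_cvg0P; exact: h2.
Qed.

(** Almost surely some simple process lies at finite distance from [H], and simple processes have
    finite norm; [sqnorm_young] with parameter 1 combines the two. *)
Lemma ito_square_integrable H I : is_ito_integral P W H I ->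
  {ae P, forall w, (l2norm2 (H ^~ w) < +oo)%E}.
Proof.
move=> HI; have mH := ito_jointly_measurable HI.
have [S [mS cS]] := ito_error_cvg HI.
have [sub] := cvg0_in_probability_subseq mS cS.
apply: filterS => w /ito_error_split[/fine_cvgP[[n _ /(_ n (leqnn n)) fin] _] _].
have mSn := jointly_measurable_simple (S (sub n)).
apply: le_lt_trans (@l2norm2_le_lin (1 + 1) (1 + 1^-1) H (sp_eval (S (sub n)))
  (fun s w => H s w - sp_eval (S (sub n)) s w) w _ _ mH mSn _ _) _ => //.
- exact: jointly_measurable_sub.
- by move=> s; exact: sqnorm_young.
rewrite -(fineK (l2norm2_simple_fin_num1 _ _)).
rewrite (_ : l2norm2 (fun s => _ - _) =
    l2norm2 (fun s => sp_eval (S (sub n)) s w - H s w)).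
  by rewrite -(fineK fin) -!EFinM -EFinD ltry.
apply: eq_integral => s _; congr EFin; rewrite !sqnormE; apply: eq_bigr => i _.
by rewrite !mxE -sqrrN opprB.
Qed.

Section two_integrals.
Variables (H H' : R -> O -> vec R d) (I I' : R -> O -> R).
Hypotheses (HI : is_ito_integral P W H I) (HI' : is_ito_integral P W H' I').

Let TT : T \in `[0, T]. Proof. by rewrite in_itv/= lexx ltW. Qed.
Let mH : jointly_measurable H. Proof. exact: ito_jointly_measurable HI. Qed.
Let mH' : jointly_measurable H'. Proof. exact: ito_jointly_measurable HI'. Qed.
Let mI : measurable_fun setT (I T). Proof. by case: HI => _ /(_ _ TT). Qed.
Let mI' : measurable_fun setT (I' T). Proof. by case: HI' => _ /(_ _ TT). Qed.

Lemma l2norm2_lin_comb_fin_num a b w :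
  (l2norm2 (H ^~ w) < +oo)%E -> (l2norm2 (H' ^~ w) < +oo)%E ->
  l2norm2 (fun s => a *: H s w + b *: H' s w) \is a fin_num.
Proof.
move=> h h'; rewrite ge0_fin_numE ?l2norm2_ge0//.
apply: le_lt_trans (@l2norm2_le_lin (2 * a ^+ 2) (2 * b ^+ 2) _ H H' w _ _
  (jointly_measurable_lin_comb a b mH mH') mH mH' _) _.
- by rewrite mulr_ge0// sqr_ge0.
- by rewrite mulr_ge0// sqr_ge0.
- move=> s; have := sqnorm_lin_comb_sub a b (H s w) (H' s w) 0 0.
  by rewrite !scaler0 !subr0 addr0 subr0.
have fin K : (l2norm2 K < +oo -> exists r, l2norm2 K = r%:E)%E.
  move=> K1; exists (fine (l2norm2 K)).
  by rewrite fineK// ge0_fin_numE// l2norm2_ge0.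
by have [r ->] := fin _ h; have [r' ->] := fin _ h'; rewrite -!EFinM -EFinD ltry.
Qed.

(* Equality holds for simple processes; the inequality survives the limit by
   Fatou's lemma. *)
Lemma integral_exp_ito a b :
  (\int[P]_w (expR (a * I T w + b * I' T w
     - 2^-1 * fine (l2norm2 (fun s => a *: H s w + b *: H' s w))))%:E <= 1)%E.
Proof.
have [S [mS cS]] := ito_error_cvg HI; have [S' [mS' cS']] := ito_error_cvg HI'.
have mSS' n : measurable_fun setT
    (fun w => `|ito_error H I S n w| + `|ito_error H' I' S' n w|)%E.
  by apply: emeasurable_funD; exact: measurableT_comp.
have [sub subP] := cvg0_in_probability_subseq mSS'
  (cvg0_in_probability_add mS mS' cS cS').
(* [c n] will bound the squared distance between the simple combination and its limit. *)
pose c n w := 2 * a ^+ 2 * fine (l2norm2 (fun s => sp_eval (S (sub n)) s w - H s w))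
  + 2 * b ^+ 2 * fine (l2norm2 (fun s => sp_eval (S' (sub n)) s w - H' s w)).
have c0 n w : 0 <= c n w.
  by rewrite addr_ge0// mulr_ge0 ?fine_ge0 ?l2norm2_ge0// mulr_ge0// sqr_ge0.
(* The Young parameter must tend to 0 while [c n] divided by it also does. The square root of [c n]
   achieves both, and the added harmonic term keeps it positive where [c n] vanishes. *)
pose e n w := Num.sqrt (c n w) + n.+1%:R^-1.
have e0 n w : 0 < e n w by rewrite ltr_wpDl// ?sqrtr_ge0// invr_gt0 ltr0n.
pose A w := fine (l2norm2 (fun s => a *: H s w + b *: H' s w)).
(* The exponent subtracts an upper bound of the quadratic variation of the simple combination, so
   [L n] is almost surely below an exponential of mean 1. Thus a one-sided comparison of norms
   suffices, and the bound converges to [A]. *)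
pose L n w := expR (a * sp_int (S (sub n)) T w + b * sp_int (S' (sub n)) T w
  - 2^-1 * ((1 + e n w) * A w + (c n w + Num.sqrt (c n w)))).
have mc n : measurable_fun setT (c n).
  apply: measurable_funD; apply: measurable_funM => //;
  by apply: measurable_fine_l2norm2; apply: jointly_measurable_sub => //;
    exact: jointly_measurable_simple.
have msc n : measurable_fun setT (fun w => Num.sqrt (c n w)).
  apply: measurableT_comp => //.
  by apply: continuous_measurable_fun; exact: sqrt_continuous.
have mA : measurable_fun setT A.
  exact: (measurable_fine_l2norm2 (jointly_measurable_lin_comb a b mH mH')).
have mL n : measurable_fun setT (L n).
  apply: measurableT_comp => //; apply: measurable_funB.
    by apply: measurable_funD; apply: measurable_funM => //; exact: measurable_sp_int.
  apply: measurable_funM => //; apply: measurable_funD; last exact: measurable_funD.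
  by apply: measurable_funM => //; do 2 apply: measurable_funD => //.
apply: (@integral_le_ae_cvg _ _ _ P L).
- exact: mL.
- apply: measurableT_comp => //; apply: measurable_funB.
    by apply: measurable_funD; exact: measurable_funM.
  exact: measurable_funM.
- by move=> n x; exact: expR_ge0.
- by move=> x; exact: expR_ge0.
- move=> n.
  rewrite -(integral_exp_simple W_brownian T_gt0 (S (sub n)) (S' (sub n)) a b).
  have mSn := jointly_measurable_simple (S (sub n)).
  have mSn' := jointly_measurable_simple (S' (sub n)).
  apply: ae_ge0_le_integral => //.
  + by move=> w _; rewrite lee_fin expR_ge0.
  + by apply/measurable_EFinP; exact: mL.
  + apply/measurable_EFinP/measurableT_comp => //; apply: measurable_funB.
      by apply: measurable_funD; apply: measurable_funM => //; exact: measurable_sp_int.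
    apply: measurable_funM; first exact: measurable_cst.
    exact: (measurable_fine_l2norm2 (jointly_measurable_lin_comb a b mSn mSn')).
  + move: (ito_square_integrable HI) (ito_square_integrable HI').
    apply: filterS2 => w Hw Hw' _; rewrite lee_fin ler_expR lerD2l lerN2 ler_pM2l//.
    have finA := l2norm2_lin_comb_fin_num a b Hw Hw'.
    have dist_fin (K : R -> O -> vec R d) (U : simple_process P W) :
        jointly_measurable K -> (l2norm2 (K ^~ w) < +oo)%E ->
        l2norm2 (fun s => sp_eval U s w - K s w) \is a fin_num.
      move=> mK Kw; have mU := jointly_measurable_simple U.
      rewrite ge0_fin_numE ?l2norm2_ge0//.
      apply: le_lt_trans (@l2norm2_le_lin 2 2 (fun s w => sp_eval U s w - K s w)
        (sp_eval U) K w _ _ _ mU mK _) _ => //.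
      - exact: jointly_measurable_sub.
      - move=> s; have := sqnorm_lin_comb_sub 1 (-1) (sp_eval U s w) (K s w) 0 0.
        by rewrite !scaler0 !subr0 addr0 scale1r scaleN1r subr0 sqrrN expr1n !mulr1.
      rewrite -(fineK (l2norm2_simple_fin_num1 U w)).
      have : l2norm2 (K ^~ w) \is a fin_num by rewrite ge0_fin_numE ?l2norm2_ge0.
      by move=> /fineK <-; rewrite -!EFinM -EFinD ltry.
    have h1 := @l2norm2_le_lin (1 + e n w) (1 + (e n w)^-1)
      (fun s w => a *: sp_eval (S (sub n)) s w + b *: sp_eval (S' (sub n)) s w)
      (fun s w => a *: H s w + b *: H' s w)
      (fun s w => (a *: sp_eval (S (sub n)) s w + b *: sp_eval (S' (sub n)) s w)
         - (a *: H s w + b *: H' s w)) w.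
    have h2 := @l2norm2_le_lin (2 * a ^+ 2) (2 * b ^+ 2)
      (fun s w => (a *: sp_eval (S (sub n)) s w + b *: sp_eval (S' (sub n)) s w)
         - (a *: H s w + b *: H' s w))
      (fun s w => sp_eval (S (sub n)) s w - H s w)
      (fun s w => sp_eval (S' (sub n)) s w - H' s w) w.
    have mSS := jointly_measurable_lin_comb a b mSn mSn'.
    have mHH := jointly_measurable_lin_comb a b mH mH'.
    have mD := jointly_measurable_sub mSS mHH.
    have {}h2 : (l2norm2 (fun s =>
        ((a *: sp_eval (S (sub n)) s w + b *: sp_eval (S' (sub n)) s w)
         - (a *: H s w + b *: H' s w))%R) <= (c n w)%:E)%E.
      rewrite /c EFinD !EFinM !fineK ?dist_fin//; apply: h2 => //.
      - by rewrite mulr_ge0// sqr_ge0.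
      - by rewrite mulr_ge0// sqr_ge0.
      - exact: jointly_measurable_sub.
      - exact: jointly_measurable_sub.
      - by move=> s; exact: sqnorm_lin_comb_sub.
    have einv0 : 0 <= 1 + (e n w)^-1 by rewrite addr_ge0// invr_ge0 ltW.
    have e10 : 0 <= 1 + e n w by rewrite addr_ge0// ltW.
    have {}h1 := h1 e10 einv0 mSS mHH mD (fun s => sqnorm_young _ _ (e0 n w)).
    rewrite -lee_fin (fineK (l2norm2_simple_fin_num _ _ _ _ _)).
    apply: le_trans h1 _; rewrite [leRHS]EFinD [X in (_ <= X + _)%E]EFinM (fineK finA).
    rewrite leeD2l//.
    apply: le_trans (lee_wpmul2l _ h2) _; first by rewrite lee_fin.
    (* The quotient of [c n] by [e n] is at most the square root of [c n], because [e n] is at least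
       that root. *)
    rewrite -EFinM lee_fin mulrDl mul1r lerD2l ler_pdivrMl//.
    apply: (@le_trans _ _ (Num.sqrt (c n w) * Num.sqrt (c n w))).
      by rewrite -expr2 sqr_sqrtr.
    by rewrite ler_wpM2r ?sqrtr_ge0// /e lerDl invr_ge0 ler0n.
- apply: filterS subP => w h.
  have [d1 i1] := ito_error_split (cvg0_addl h).
  have [d2 i2] := ito_error_split (cvg0_addr h).
  have /fine_cvg {}d1 := d1; have /fine_cvg {}d2 := d2.
  have cc : c n w @[n --> \oo] --> 0.
    rewrite [X in _ --> X](_ : 0 = 2 * a ^+ 2 * 0 + 2 * b ^+ 2 * 0).
      by apply: cvgD; apply: cvgM => //; exact: cvg_cst.
    by rewrite !mulr0 addr0.
  have csc : Num.sqrt (c n w) @[n --> \oo] --> 0.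
    rewrite [X in _ --> X](_ : 0 = Num.sqrt 0); last by rewrite sqrtr0.
    by apply: cvg_comp cc _; exact: sqrt_continuous.
  have ce : e n w @[n --> \oo] --> 0.
    rewrite [X in _ --> X](_ : 0 = 0 + 0); last by rewrite addr0.
    by apply: cvgD => //; exact: cvg_harmonic.
  apply: (cvg_comp _ expR); last exact: continuous_expR.
  apply: cvgB; first by apply: cvgD; apply: cvgM => //; exact: cvg_cst.
  apply: cvgM; first exact: cvg_cst.
  rewrite [X in _ --> X](_ : A w = (1 + 0) * A w + (0 + 0)).
    apply: cvgD; last exact: cvgD.
    by apply: cvgM; [apply: cvgD => //; exact: cvg_cst|exact: cvg_cst].
  by rewrite !addr0 mul1r.
Qed.

(** Where both squared norms are finite, hence almost surely, integrating [sqnorm_convex] in time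
    identifies this exponent with that of the combination of weights [l] and [1 - l]. *)
Lemma integral_exp_ito_convex (l : R) : 0 <= l -> l <= 1 ->
  (\int[P]_w (expR (l * (I T w - 2^-1 * fine (l2norm2 (H ^~ w)))
     + (1 - l) * (I' T w - 2^-1 * fine (l2norm2 (H' ^~ w)))
     + l * (1 - l) * (2^-1 * fine (l2norm2 (fun s => H' s w - H s w)))))%:E
   <= 1)%E.
Proof.
move=> l0 l1; apply: le_trans (integral_exp_ito l (1 - l)).
have mH1 := measurable_fine_l2norm2 mH; have mH1' := measurable_fine_l2norm2 mH'.
have mD := measurable_fine_l2norm2 (jointly_measurable_sub mH' mH).
apply: ae_ge0_le_integral => //.
- apply/measurable_EFinP/measurableT_comp => //.
  apply: measurable_funD; last by do 2 apply: measurable_funM => //.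
  by apply: measurable_funD; apply: measurable_funM => //; apply: measurable_funB => //;
    exact: measurable_funM.
- apply/measurable_EFinP/measurableT_comp => //; apply: measurable_funB.
    by apply: measurable_funD; exact: measurable_funM.
  apply: measurable_funM; first exact: measurable_cst.
  exact: (measurable_fine_l2norm2 (jointly_measurable_lin_comb l (1 - l) mH mH')).
move: (ito_square_integrable HI) (ito_square_integrable HI').
apply: filterS2 => w Hw Hw' _; rewrite lee_fin ler_expR.
have fin : l2norm2 (H ^~ w) \is a fin_num by rewrite ge0_fin_numE ?l2norm2_ge0.
have fin' : l2norm2 (H' ^~ w) \is a fin_num by rewrite ge0_fin_numE ?l2norm2_ge0.
have finC := l2norm2_lin_comb_fin_num l (1 - l) Hw Hw'.
have finD : l2norm2 (fun s => H' s w - H s w) \is a fin_num.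
  have := l2norm2_lin_comb_fin_num (-1) 1 Hw Hw'.
  rewrite (_ : (fun s => _) = (fun s => H' s w - H s w))//.
  by apply/funext => s; rewrite scale1r scaleN1r addrC.
have ll : 0 <= l * (1 - l) by rewrite mulr_ge0// subr_ge0.
have E : fine (l2norm2 (fun s => l *: H s w + (1 - l) *: H' s w))
   + l * (1 - l) * fine (l2norm2 (fun s => H' s w - H s w)) =
   l * fine (l2norm2 (H ^~ w)) + (1 - l) * fine (l2norm2 (H' ^~ w)).
  apply: EFin_inj; rewrite !EFinD !EFinM !fineK//.
  rewrite -EFinM -[X in (X + _)%E = _]mul1e /l2norm2.
  rewrite -!ge0_integral_lin ?subr_ge0//;
    try exact: measurable_sqnorm_section; try by move=> s _; exact: sqnorm_ge0.
  - by apply: eq_integral => s _; rewrite mul1r sqnorm_convex.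
  - exact: (measurable_sqnorm_section w (jointly_measurable_lin_comb l (1 - l) mH mH')).
  - exact: (measurable_sqnorm_section w (jointly_measurable_sub mH' mH)).
lra.
Qed.

End two_integrals.
End ito_exponential.

(** * Measurability of path functionals *)

Section path_evaluation.
Context (R : realType) (d : nat) (T : R) (x0 : vec R d).
Hypothesis T_gt0 : 0 < T.

Lemma path_continuousP (x : cpath T x0) s e : s \in `[0, T] -> 0 < e ->
  exists2 r : R, 0 < r & forall t, t \in `[0, T] -> `|s - t| < r ->
    ball (x s) e (x t).
Proof.
move=> sT e0; have sT' : `[0, T]%classic s by [].
have h : nbhs (x s) (ball (x s) e) by exact: nbhsx_ballx.
have : nbhs_subspace (A := `[0, T]%classic) s (x @^-1` ball (x s) e).
  exact: (@path_continuous _ _ _ _ x) s _ h.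
rewrite -nbhs_subspace_in// => /nbhs_ballP[r r0 hr].
exists r => // t tT str; apply: hr => //.
Qed.

(** The retraction of the line onto [0, T]. Evaluation at the clamped time is a function on the
    whole product of times and paths, and only involves times at which paths are continuous. *)
Definition clamp (s : R) : R := Num.max 0 (Num.min s T).

Lemma clamp_in s : clamp s \in `[0, T].
Proof. by rewrite in_itv/= /clamp le_max lexx/= ge_max ge_min lexx orbT ltW. Qed.

Lemma clamp_id s : s \in `[0, T] -> clamp s = s.
Proof. by rewrite in_itv/= /clamp => /andP[s0 sT]; rewrite min_l// max_r. Qed.

Lemma measurable_clamp : measurable_fun [set: R] clamp.
Proof. by apply: measurable_maxr => //; exact: measurable_minr. Qed.

(** Rounding down to a multiple of 1/(n+1) keeps the discretized time in [0, T]. *)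
Let grid (n : nat) (s : R) : R := (Num.truncn (clamp s * n.+1%:R))%:R / n.+1%:R.

Let clamp_ge0 s n : 0 <= clamp s * n.+1%:R.
Proof. by rewrite mulr_ge0//; have := clamp_in s; rewrite in_itv/= => /andP[]. Qed.

Let grid_le n s : grid n s <= clamp s.
Proof. by rewrite ler_pdivrMr ?ltr0n//; have /andP[] := truncn_itv (clamp_ge0 s n). Qed.

Let grid_in n s : grid n s \in `[0, T].
Proof.
rewrite in_itv/= divr_ge0//= (le_trans (grid_le n s))//.
by have := clamp_in s; rewrite in_itv/= => /andP[].
Qed.

Let grid_dist n s : `|clamp s - grid n s| < n.+1%:R^-1.
Proof.
rewrite ger0_norm ?subr_ge0// ltrBlDr -[X in _ < X + _]mul1r -mulrDl.
rewrite ltr_pdivlMr ?ltr0n//; have /andP[_] := truncn_itv (clamp_ge0 s n).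
by move=> h; apply: lt_le_trans h _; rewrite addrC natr1.
Qed.

Let measurable_ev_grid n (F : set (borelMx R d 1)) : measurable F ->
  measurable [set z : R * pathSpace T x0 | F (ev z.2 (grid n z.1))].
Proof.
move=> mF.
rewrite (_ : mkset _ = \bigcup_k
    ([set s | Num.truncn (clamp s * n.+1%:R) = k]
     `*` [set x : pathSpace T x0 | F (ev x (k%:R / n.+1%:R))])).
  apply: bigcupT_measurable => k; apply: measurableX; last first.
    by rewrite -[X in measurable X]setTI; exact: measurable_ev.
  rewrite (_ : mkset _ = (fun s => clamp s * n.+1%:R) @^-1` `[k%:R, k.+1%:R[).
    rewrite -[X in measurable X]setTI; apply: measurable_funM => //.
    exact: measurable_clamp.
  apply/seteqP; split => s /=; rewrite in_itv/= => h.
    by rewrite -h truncn_itv.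
  exact: truncn_def.
apply/seteqP; split => [[s x] /= h|[s x] [k _ [/= <-]]//].
by exists (Num.truncn (clamp s * n.+1%:R)).
Qed.

(* Caratheodory's argument: evaluation is measurable in the path and
   continuous in time, so it is the limit of its discretizations in time. *)
Lemma measurable_ev_clamp : measurable_fun setT
  (fun z : R * pathSpace T x0 => ev z.2 (clamp z.1) : borelMx R d 1).
Proof.
apply: (@measurability _ _ _ (borelMx R d 1) _ _ open) => //.
move=> /= _ [U oU <-]; rewrite setTI.
(* The points at distance at least 1/(m+1) from the complement of [U]. Without a fixed margin,
   discretizations that lie in the open set [U] could still converge to a point of its boundary. *)
pose F m := [set y : vec R d | ball y m.+1%:R^-1 `<=` U].
have mF m : measurable (F m : set (borelMx R d 1)).
  rewrite -[F m]setCK; apply: measurableC; apply: sub_sigma_algebra.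
  rewrite (_ : ~` F m = \bigcup_(y in ~` U) ball y m.+1%:R^-1).
    by apply: bigcup_open => y _; exact: ball_open.
  apply/seteqP; split => y /=.
    move=> /existsNP[y' /not_implyP[yy' Uy']]; exists y' => //.
    exact: ball_sym.
  by move=> [y' Uy' yy'] h; apply: Uy'; apply: h; exact: ball_sym.
rewrite (_ : _ @^-1` U = \bigcup_m \bigcup_N \bigcap_(n in [set n | (N <= n)%N])
    [set z : R * pathSpace T x0 | F m (ev z.2 (grid n z.1))]).
  do 2 apply: bigcupT_measurable => ?.
  by apply: bigcap_measurableType => n _; exact: measurable_ev_grid.
apply/seteqP; split => [[s x] /= Ux|[s x] [m _ [N _ h]] /=].
  have /nbhs_ballP[e e0 eU] : nbhs (ev x (clamp s)) U by exact: open_nbhs_nbhs.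
  have e20 : 0 < e / 2 by rewrite divr_gt0.
  have [r r0 hr] := path_continuousP x (clamp_in s) e20.
  have near_inv (a : R) : 0 < a -> exists N, forall n, (N <= n)%N -> n.+1%:R^-1 < a.
    move=> a0; have := @cvg_harmonic R => /cvgrPdist_lt/(_ _ a0)[N _ hN].
    exists N => n /hN; rewrite /= sub0r normrN ger0_norm// harmonic_ge0.
  have [m /(_ m (leqnn m)) hm] := near_inv _ e20.
  have [N hN] := near_inv _ r0.
  exists m => //; exists N => // n /= Nn y yb; apply: eU.
  rewrite (splitr e); apply: ball_triangle (le_ball (ltW hm) yb).
  by apply: hr (grid_in n s) _; apply: lt_trans (grid_dist n s) (hN _ Nn).
have m0 : 0 < m.+1%:R^-1 :> R by rewrite invr_gt0 ltr0n.
have [r r0 hr] := path_continuousP x (clamp_in s) m0.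
have := @cvg_harmonic R => /cvgrPdist_lt/(_ _ r0)[N' _ hN'].
pose n := maxn N N'.
apply: (h n); first exact: leq_maxl.
apply/ball_sym/hr => //; apply: lt_trans (grid_dist n s) _.
by have := hN' n (leq_maxr _ _); rewrite /= sub0r normrN ger0_norm// harmonic_ge0.
Qed.

Lemma measurable_along_path dV (V : measurableType dV) (q : vec R d -> R -> V) :
  measurable_fun ([set: borelMx R d 1] `*` `[0, T]%classic)
    (fun z : borelMx R d 1 * R => q z.1 z.2) ->
  measurable_fun (`[0, T]%classic `*` [set: pathSpace T x0])
    (fun z : R * pathSpace T x0 => q (ev z.2 z.1) z.1).
Proof.
move=> mq.
have mc : measurable_fun setT (fun z : R * pathSpace T x0 => clamp z.1).
  exact: (measurableT_comp measurable_clamp).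
pose e (z : R * pathSpace T x0) : borelMx R d 1 * R := (ev z.2 (clamp z.1), clamp z.1).
have me : measurable_fun setT e.
  by apply: measurable_fun_pair => //; exact: measurable_ev_clamp.
have : measurable_fun setT ((fun z : borelMx R d 1 * R => q z.1 z.2) \o e).
  apply: measurable_comp mq me; first exact: measurableX.
  by move=> _ [z _ <-]; split => //=; exact: clamp_in.
move=> /measurable_funTS h; apply: eq_measurable_fun (h _) => -[s x].
by rewrite inE => -[/= sT _]; rewrite clamp_id.
Qed.

Lemma measurable_work (f : vec R d -> R -> R) (g : vec R d -> R) :
  measurable_fun ([set: borelMx R d 1] `*` `[0, T]%classic)
    (fun z : borelMx R d 1 * R => f z.1 z.2) ->
  measurable_fun [set: borelMx R d 1] (g : borelMx R d 1 -> R) ->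
  measurable_fun [set: pathSpace T x0] (@work R d T x0 f g).
Proof.
move=> mf mg; have mfp := measurable_along_path mf.
apply: emeasurable_funD; last first.
  apply/measurable_EFinP.
  apply: (@measurableT_comp _ _ _ _ _ R (g : borelMx R d 1 -> R) setT
    (fun x : pathSpace T x0 => ev x T : borelMx R d 1)) => //.
  exact: measurable_ev.
(* [f] has no sign, whereas measurability of time integrals rests on Tonelli's theorem; each part is
   treated separately. *)
under eq_fun do rewrite integralE.
apply: emeasurable_funB.
  apply: eq_measurable_fun (@measurable_time_integral _ _ _ T
    (fun z : R * pathSpace T x0 => Num.max (f (ev z.2 z.1) z.1) 0) _ _).
  - by move=> x _; apply: eq_integral => s _; rewrite funeposE EFin_max.
  - by move=> z; rewrite le_max lexx orbT.
  - exact: measurable_maxr.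
apply: eq_measurable_fun (@measurable_time_integral _ _ _ T
  (fun z : R * pathSpace T x0 => Num.max (- f (ev z.2 z.1) z.1) 0) _ _).
- by move=> x _; apply: eq_integral => s _; rewrite funenegE EFin_max.
- by move=> z; rewrite le_max lexx orbT.
- by apply: measurable_maxr => //; exact: measurable_funN.
Qed.

End path_evaluation.

(** * Densities of probability measures *)

Section nonnegative_density.
Context (R : realType) (dE : measure_display) (E : measurableType dE).
Local Open Scope ereal_scope.
Implicit Types p q nu : probability E R.

(* Unlike [density], which may be negative on a null set, this version is
   nonnegative everywhere. *)
Definition rn p q (x : E) : R := fine (Radon_Nikodym_SigmaFinite.f p q x).

Lemma rnE p q : p `<< q ->
  EFin \o rn p q = Radon_Nikodym_SigmaFinite.f p q.
Proof.
by move=> pq; apply/funext => x /=; rewrite fineK// Radon_Nikodym_SigmaFinite.f_fin_num.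
Qed.

Lemma rn_ge0 p q x : p `<< q -> (0 <= rn p q x)%R.
Proof. by move=> pq; rewrite fine_ge0// Radon_Nikodym_SigmaFinite.f_ge0. Qed.

Lemma measurable_rn p q : p `<< q -> measurable_fun setT (rn p q).
Proof.
move=> pq; apply/measurable_EFinP; rewrite rnE//.
exact: measurable_int (Radon_Nikodym_SigmaFinite.f_integrable pq).
Qed.

Lemma integral_rn p q A : p `<< q -> measurable A ->
  \int[q]_(x in A) (rn p q x)%:E = p A.
Proof.
by move=> pq mA; rewrite (Radon_Nikodym_SigmaFinite.f_integral pq)// -rnE.
Qed.

Lemma ge0_integral_rn p q A (f : E -> \bar R) : p `<< q -> measurable A ->
  (forall x, 0 <= f x) -> measurable_fun A f ->
  \int[q]_(x in A) (f x * (rn p q x)%:E) = \int[p]_(x in A) f x.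
Proof.
move=> pq mA f0 mf; rewrite -(Radon_Nikodym_SigmaFinite.change_of_variables pq)//.
by rewrite -rnE.
Qed.

Lemma density_fin_num p q x : p `<< q -> density p q x \is a fin_num.
Proof. by move=> pq; apply: Radon_Nikodym_fin_num. Qed.

Lemma measurable_density p q : p `<< q -> measurable_fun setT (density p q).
Proof. by move=> pq; apply: measurable_int; exact: Radon_Nikodym_integrable. Qed.

Lemma density_rn p q : p `<< q -> {ae q, forall x, density p q x = (rn p q x)%:E}.
Proof.
move=> pq; have := ae_eq_Radon_Nikodym_SigmaFinite pq measurableT.
rewrite -rnE//; apply: filterS => x /(_ I) h; exact/esym/h.
Qed.

Lemma ae_dominates p q (Q : E -> Prop) : p `<< q ->
  {ae q, forall x, Q x} -> {ae p, forall x, Q x}.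
Proof.
move=> /null_content_dominatesP pq [N [mN N0 QN]]; exists N; split => //; exact: pq.
Qed.

Lemma rn_chain p q nu : p `<< q -> q `<< nu ->
  {ae nu, forall x, rn p nu x = (rn p q x * rn q nu x)%R}.
Proof.
move=> pq qnu; have pnu := null_dominates_trans pq qnu.
have := Radon_Nikodym_SigmaFinite.chain_rule pq qnu measurableT.
rewrite -!rnE//; apply: filterS => x /(_ I) /= h.
by apply: EFin_inj; rewrite h EFinM.
Qed.

(** Positive and negative parts are compared separately, so that the bound applies to the logarithm
    of a density before anything is known about its integrability. *)
Lemma integral_le_integrable p (f : E -> \bar R) (g : E -> R) :
  measurable_fun setT f -> measurable_fun setT g ->
  (forall x, f x <= (g x)%:E) -> \int[p]_x f x <= \int[p]_x (g x)%:E.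
Proof.
move=> mf mg fg; have mgE : measurable_fun setT (EFin \o g) by exact/measurable_EFinP.
rewrite integralE [leRHS]integralE; apply: leeB.
  apply: ge0_le_integral => //; try exact: measurable_funepos.
  by move=> x _; rewrite !funeposE; apply: le_max2 => //=.
apply: ge0_le_integral => //; try exact: measurable_funeneg.
move=> x _; have := fg x; rewrite -leeN2 => h.
by rewrite !funenegE; exact: le_max2.
Qed.

Lemma measurable_lne (h : E -> \bar R) : (forall x, h x \is a fin_num) ->
  measurable_fun setT h -> measurable_fun setT (fun x => lne (h x)).
Proof.
move=> hfin mh.
have mfh : measurable_fun setT (fun x => fine (h x)).
  exact: (measurableT_comp (fine_measurable measurableT) mh).
rewrite (_ : (fun x => _) =
    (fun x => if (fine (h x) <= 0)%R then -oo else (ln (fine (h x)))%:E)).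
  apply: measurable_fun_ifT => //.
    by apply: measurable_fun_ler.
  by apply/measurable_EFinP; exact: measurableT_comp.
apply/funext => x; rewrite -{1}(fineK (hfin x)); case: ltP => hx.
  by rewrite lne_EFin.
by rewrite le0_lneNy.
Qed.

(** The graph of the logarithm lies below its tangent at [c]; this is e^t >= 1 + t at t = ln x - ln
    c. *)
Lemma ln_div_le (x c : R) : (0 < x)%R -> (0 < c)%R -> (ln x <= x / c - 1 + ln c)%R.
Proof.
move=> x0 c0; have := expR_ge1Dx (ln x - ln c).
rewrite expRB !lnK// => h; rewrite -subr_ge0; move: h; rewrite -subr_ge0.
by congr (_ <= _)%R; ring.
Qed.

Section chi_square.
Variables p q : probability E R.
Hypothesis pq : p `<< q.

Let D := rn p q.
Let mD : measurable_fun setT D. Proof. exact: measurable_rn. Qed.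
Let D0 x : (0 <= D x)%R. Proof. exact: rn_ge0. Qed.

Lemma chi_squareE :
  \int[p]_x (D x)%:E = \int[q]_x ((D x - 1) ^+ 2)%:E + 1.
Proof.
have mDE : measurable_fun setT (EFin \o D) by exact/measurable_EFinP.
have m1 : measurable_fun setT (fun x => (D x - 1) ^+ 2)%R.
  by apply: measurable_funX; exact: measurable_funB.
(* Only nonnegative terms appear on either side, so integration is additive even if the integrals
   are infinite; the finite constant is cancelled afterwards. *)
have h : \int[q]_x ((D x ^+ 2)%:E + 1) =
    \int[q]_x (((D x - 1) ^+ 2)%:E + 2%:E * (D x)%:E).
  by apply: eq_integral => x _; rewrite -EFinM -!EFinD; congr EFin; ring.
rewrite !ge0_integralD// in h; last 6 first.
- by move=> x _; rewrite lee_fin sqr_ge0.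
- exact/measurable_EFinP.
- by move=> x _; rewrite mule_ge0// lee_fin.
- exact: measurable_funeM.
- by move=> x _; rewrite lee_fin sqr_ge0.
- by apply/measurable_EFinP; exact: measurable_funX.
rewrite integral_cst//= probability_setT mule1 in h.
rewrite ge0_integralZl_EFin// in h; last by move=> x _; rewrite lee_fin.
rewrite integral_rn// probability_setT mule1 in h.
rewrite -(ge0_integral_rn pq measurableT _ mDE)//.
under eq_integral do rewrite -EFinM -expr2.
have : \int[q]_x (D x ^+ 2)%:E + 1 - 1 =
    \int[q]_x ((D x - 1) ^+ 2)%:E + 2%:E - 1 by rewrite h.
rewrite addeK// => ->; rewrite -addeA; congr (_ + _).
by rewrite -EFinB; congr EFin; ring.
Qed.

Lemma expeR_KL_le :
  expeR (KL p q) - 1 <= \int[q]_x ((D x - 1) ^+ 2)%:E.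
Proof.
have chi0 : 0 <= \int[q]_x ((D x - 1) ^+ 2)%:E.
  by apply: integral_ge0 => x _; rewrite lee_fin sqr_ge0.
move: chi0 chi_squareE; case: (\int[q]_x ((D x - 1) ^+ 2)%:E) => [r| |//];
  last by move=> _ _; rewrite leey.
rewrite lee_fin => r0 cE; pose c := (r + 1)%R.
have c0 : (0 < c)%R by rewrite ltr_wpDl.
have mden : measurable_fun setT (density p q) by exact: measurable_density.
(* The tangent is first written with [density], as [KL] is, so that the comparison holds at every
   point, including those where the density is not positive and [lne] is -oo. It is exchanged for
   [D] almost everywhere below. *)
pose G x := (fine (density p q x) / c - 1 + ln c)%R.
have mG : measurable_fun setT G.
  apply: measurable_funD => //; apply: measurable_funB => //.
  apply: measurable_funM => //.
  exact: (measurableT_comp (fine_measurable measurableT) mden).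
rewrite leeBlDr// -EFinD -/c.
rewrite (_ : c%:E = expeR (ln c)%:E); last by rewrite /= lnK.
rewrite lee_expeR.
apply: le_trans (@integral_le_integrable p _ G _ mG _) _.
- by apply: measurable_lne => // x; exact: density_fin_num.
- move=> x; rewrite -{1}(fineK (density_fin_num x pq)).
  have [h|h] := ltP 0%R (fine (density p q x)).
    by rewrite lne_EFin// lee_fin ln_div_le.
  by rewrite le0_lneNy// leNye.
rewrite (@ae_eq_integral _ _ _ p setT (fun x => (D x / c - 1 + ln c)%:E))//.
- have iD : p.-integrable setT (EFin \o D).
    apply/integrableP; split; first exact/measurable_EFinP.
    under eq_integral do rewrite gee0_abs ?lee_fin//.
    by rewrite [X in X < _]cE ltry.
  under eq_integral do rewrite -addrA mulrC EFinD EFinM.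
  rewrite integralD//; last 2 first.
  - exact: integrableZl.
  - exact: finite_measure_integrable_cst.
  rewrite integralZl// integral_cst//= probability_setT mule1 (_ : \int[p]_x _ = c%:E)//.
  rewrite -EFinM -EFinD.
  by rewrite mulVf ?gt_eqF// lee_fin addrA subrr add0r.
- exact/measurable_EFinP.
- apply/measurable_EFinP; apply: measurable_funD => //; apply: measurable_funB => //.
  exact: measurable_funM.
- apply: (ae_dominates pq); apply: filterS (density_rn pq) => x h _.
  by rewrite /G h.
Qed.

End chi_square.

(** Both [rn p q] and [h / Z] times [rn mu q] are densities of [p] with respect to [q], and these
    are unique up to a null set. For [h] the exponential of minus the work, the left-hand side is
    the reweighted integrand of the relative error. *)
Lemma importance_weight (mu q p : probability E R) (h : E -> \bar R) (Z : R) :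
  (0 < Z)%R -> mu `<< q -> p `<< q ->
  measurable_fun setT h -> (forall x, 0 <= h x) ->
  (forall A, measurable A -> p A = \int[mu]_(x in A) (h x * Z^-1%:E)) ->
  {ae q, forall x, fine (h x * density mu q x) = (Z * rn p q x)%R}.
Proof.
move=> Z0 muq pq mh h0 pE.
have Zi0 : 0 <= Z^-1%:E by rewrite lee_fin invr_ge0 ltW.
have mhZ : measurable_fun setT (fun x => h x * Z^-1%:E) by exact: emeasurable_funM.
have irn : q.-integrable setT (EFin \o rn p q).
  by rewrite rnE//; exact: Radon_Nikodym_SigmaFinite.f_integrable.
have mrn : measurable_fun setT (fun x => (rn mu q x)%:E).
  by apply/measurable_EFinP; exact: measurable_rn.
have : ae_eq q setT (EFin \o rn p q) (fun x => (h x * Z^-1%:E) * (rn mu q x)%:E).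
  apply: integral_ae_eq => //; first exact: emeasurable_funM.
  move=> A _ mA; rewrite /= integral_rn// pE// ge0_integral_rn//.
  - by move=> x; rewrite mule_ge0.
  - exact: measurable_funTS.
apply: filterS2 (density_rn muq) => x -> /(_ I) /= hx.
have := congr1 (fun y => Z%:E * y) hx.
rewrite /= muleAC (muleC _ Z^-1%:E) muleA -!EFinM divff ?gt_eqF// mul1e => <-.
by [].
Qed.

(** The density integrates to 1, so [Y] has mean [Z]. The variance is then the integral of the
    square of [Y - Z], a nonnegative function, and the identity covers the infinite case. *)
Lemma variance_ae_rn (dO : measure_display) (O : measurableType dO)
    (P : probability O R) (V : {mfun O >-> E}) (p : probability E R) (Z : R)
    (Y : O -> R) : (0 <= Z)%R -> p `<< distribution P V -> measurable_fun setT Y ->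
  {ae P, forall w, Y w = (Z * rn p (distribution P V) (V w))%R} ->
  'V_P[Y] = (Z ^+ 2)%:E *
    \int[distribution P V]_x ((rn p (distribution P V) x - 1) ^+ 2)%:E.
Proof.
move=> Z0 pq mY YE; set D := rn p _.
have mD : measurable_fun setT D by exact: measurable_rn.
have D0 x : (0 <= D x)%R by exact: rn_ge0.
have mDV : measurable_fun setT (fun w => D (V w)) by exact: measurableT_comp.
have EY : \int[P]_w (Y w)%:E = Z%:E.
  rewrite (@ae_eq_integral _ _ _ P setT (fun w => (Z * D (V w))%:E))//.
  - transitivity (\int[distribution P V]_x (Z * D x)%:E).
      rewrite ge0_integral_distribution//.
        by apply/measurable_EFinP; exact: measurable_funM.
      by move=> x; rewrite lee_fin mulr_ge0.
    under eq_integral do rewrite EFinM.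
    rewrite ge0_integralZl_EFin//.
    + by rewrite integral_rn// probability_setT mule1.
    + by move=> x _; rewrite lee_fin.
    + exact/measurable_EFinP.
  - exact/measurable_EFinP.
  - by apply/measurable_EFinP; exact: measurable_funM.
  - by apply: filterS YE => w -> _.
rewrite /variance covariance.unlock expectation.unlock EY /=.
rewrite (@ae_eq_integral _ _ _ P setT
  (fun w => (Z ^+ 2)%:E * ((D (V w) - 1) ^+ 2)%:E))//.
- have m2 : measurable_fun setT (fun x => ((D x - 1) ^+ 2)%:E).
    by apply/measurable_EFinP/measurable_funX; exact: measurable_funB.
  rewrite ge0_integralZl_EFin ?sqr_ge0//.
  + congr (_ * _); rewrite ge0_integral_distribution// => x.
    by rewrite lee_fin sqr_ge0.
  + by move=> x _; rewrite lee_fin sqr_ge0.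
  + exact: (measurableT_comp m2).
- by apply/measurable_EFinP/measurable_funM; exact: measurable_funB.
- apply: measurable_funeM; apply/measurable_EFinP/measurable_funX.
  exact: measurable_funB.
- apply: filterS YE => w h _.
  transitivity ((Y w - Z) * (Y w - Z))%:E => //.
  have {}h : Y w = (Z * D (V w))%R := h.
  by rewrite h -EFinM; congr EFin; ring.
Qed.

End nonnegative_density.

(** * Relative error and entropy *)

Section entropy_bound.
Context (R : realType) (dO : measure_display) (O : measurableType dO).
Variable P : probability O R.

Lemma le_of_contractions (x y : R) : 0 <= x ->
  (forall l, 0 < l -> l < 1 -> (1 - l) * x <= y) -> x <= y.
Proof.
move=> x0 h; rewrite leNgt; apply/negP => yx.
have y0 : 0 <= y.
  apply: le_trans (h 2^-1 _ _); last by rewrite invf_lt1// ltr1n.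
    by rewrite mulr_ge0// subr_ge0 invf_le1// ler1n.
  by rewrite invr_gt0.
have xp : 0 < x by exact: le_lt_trans yx.
(* For this [l], the number (1 - l) x is the midpoint of [x] and [y], which exceeds [y]. *)
have l0 : 0 < (x - y) / (2 * x) by rewrite divr_gt0 ?subr_gt0// mulr_gt0.
have l1 : (x - y) / (2 * x) < 1 by rewrite ltr_pdivrMr ?mulr_gt0//; lra.
have e : (1 - (x - y) / (2 * x)) * x = (x + y) / 2 by field; rewrite gt_eqF.
by have := h _ l0 l1; rewrite e; lra.
Qed.

(* For densities e^a and e^s, the assumption for all [l] bounds their Renyi
   divergences from below; letting l tend to 0 would give the relative entropy,
   for which the tangent inequality e^t >= 1 + t is used instead. *)
Lemma entropy_bound (a s b : O -> R) (c : R) : 1 <= c ->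
  measurable_fun setT a -> measurable_fun setT s -> measurable_fun setT b ->
  (forall w, 0 <= b w) ->
  (forall l, 0 <= l -> l <= 1 -> (\int[P]_w (expR (l * a w + (1 - l) * s w
     + l * (1 - l) * b w))%:E <= 1)%E) ->
  (\int[P]_w (expR (s w))%:E = 1)%E ->
  (\int[P]_w (expR (s w - a w) * expR (s w))%:E = c%:E)%E ->
  (\int[P]_w (b w * expR (s w))%:E <= (ln c)%:E)%E.
Proof.
move=> c1 ma ms mb b0 renyi Es Ec.
have c0 : 0 < c by exact: lt_le_trans c1.
have lnc0 : 0 <= ln c by rewrite ln_ge0.
have mes : measurable_fun setT (fun w => expR (s w)) by exact: measurableT_comp.
have mbs : measurable_fun setT (fun w => b w * expR (s w)) by exact: measurable_funM.
have mss : measurable_fun setT (fun w => expR (s w - a w) * expR (s w)).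
  by apply: measurable_funM => //; apply: measurableT_comp => //; exact: measurable_funB.
have bs0 w : 0 <= b w * expR (s w) by rewrite mulr_ge0// expR_ge0.
(* Both sides are means of nonnegative functions. The summand [1 + l] collects the constants of the
   two tangent inequalities, the second of which is weighted by [l]. *)
have key l : 0 < l -> l < 1 ->
  ((l * (1 - l))%:E * \int[P]_w (b w * expR (s w))%:E + (1 + l)%:E
   <= (1 + l * (1 + ln c))%:E)%E.
  move=> l0 l1; have l0' := ltW l0; have l1' := ltW l1.
  have ll : 0 <= l * (1 - l) by rewrite mulr_ge0// subr_ge0.
  pose V w := expR (l * a w + (1 - l) * s w + l * (1 - l) * b w).
  have mV : measurable_fun setT V.
    apply: measurableT_comp => //; apply: measurable_funD; last exact: measurable_funM.
    by apply: measurable_funD; exact: measurable_funM.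
  have ci0 : 0 <= c^-1 by rewrite invr_ge0 ltW.
  have := @ge0_integral_lin _ _ _ P setT measurableT (l * (1 - l)) (1 + l)
    (fun w => b w * expR (s w)) (fun w => expR (s w)) ll _ mbs mes.
  rewrite Es mule1 => <- //; last by rewrite addr_ge0.
  have E2 := @ge0_integral_lin _ _ _ P setT measurableT c^-1 (ln c)
    (fun w => expR (s w - a w) * expR (s w)) (fun w => expR (s w)) ci0 lnc0 mss mes.
  have := @ge0_integral_le_lin _ _ _ P setT measurableT 1 l
    (fun w => l * (1 - l) * (b w * expR (s w)) + (1 + l) * expR (s w)) V
    (fun w => c^-1 * (expR (s w - a w) * expR (s w)) + ln c * expR (s w)) ler01 l0'.
  rewrite E2; last 2 first.
  - by move=> w _; rewrite mulr_ge0// expR_ge0.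
  - by move=> w _; rewrite expR_ge0.
  move=> h; apply: le_trans (h _ _ _ _ _ _ _) _ => {h E2} //.
  - by apply: measurable_funD; exact: measurable_funM.
  - by apply: measurable_funD; exact: measurable_funM.
  - by move=> w _; rewrite addr_ge0// mulr_ge0 ?addr_ge0// expR_ge0.
  - by move=> w _; rewrite expR_ge0.
  - by move=> w _; rewrite addr_ge0// mulr_ge0// ?mulr_ge0// expR_ge0.
  - move=> w _; rewrite mul1r.
    (* [x] is the exponent of [V] relative to e^s, and e^y is D/c. In [x + l * y] the terms in ln D
       = s - a cancel, leaving l (1 - l) b - l ln c. *)
    pose x := l * (a w - s w) + l * (1 - l) * b w; pose y := s w - a w - ln c.
    have -> : V w = expR (s w) * expR x by rewrite -expRD /V /x; congr expR; ring.
    have -> : c^-1 * (expR (s w - a w) * expR (s w)) = expR (s w) * expR y.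
      by rewrite /y [expR (_ - ln c)]expRB lnK ?posrE//; ring.
    have hx := expR_ge1Dx x; have hy := expR_ge1Dx y.
    rewrite -subr_ge0 (_ : _ - _ = expR (s w) *
      ((expR x - (1 + x)) + l * (expR y - (1 + y)))); last by rewrite /x /y; ring.
    rewrite mulr_ge0 ?expR_ge0// addr_ge0 ?subr_ge0//.
    by rewrite mulr_ge0// subr_ge0.
  rewrite mul1e Ec Es mule1 -(EFinM c^-1) mulVf ?gt_eqF// -EFinD -EFinM.
  by rewrite [leRHS]EFinD leeD2r//; exact: renyi.
have X0 : (0 <= \int[P]_w (b w * expR (s w))%:E)%E.
  by apply: integral_ge0 => w _; rewrite lee_fin.
case: (\int[P]_w _)%E X0 key => [x| |//].
- rewrite !lee_fin => x0 key; apply: le_of_contractions => // l l0 l1.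
  have := key l l0 l1; rewrite -EFinM -EFinD lee_fin => h.
  by rewrite -(ler_pM2l l0); lra.
- move=> _ /(_ 2^-1); rewrite invr_gt0 invf_lt1// ltr1n ltr0n => /(_ isT isT).
  rewrite gt0_muley; last by rewrite lte_fin; lra.
  by rewrite addye// leye_eq.
Qed.

End entropy_bound.

(** * Path laws, Girsanov's formula and the relative error *)

Section path_laws.
Context (R : realType) (d : nat) (T : R) (xinit : vec R d).
Context (dO : measure_display) (O : measurableType dO) (P : probability O R).
Variable W : {mfun O >-> pathSpace T (0 : vec R d)}.

Lemma ae_law (X : {mfun O >-> pathSpace T xinit}) (Q : pathSpace T xinit -> Prop) :
  {ae law P X, forall x, Q x} -> {ae P, forall w, Q (X w)}.
Proof.
move=> [N [mN N0 QN]]; exists (X @^-1` N); split => //.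
- by rewrite -[X in measurable X]setTI; exact: measurable_funP.
- by move=> w /= h; exact: QN.
Qed.

(** Inserting dX = b ds + sigma dW, the factor sigma^-1 sigma disappears from the martingale part,
    and the drift part cancels the second term of Girsanov's exponent. The integrand [H] is kept as
    the literal matrix product, which equals the control only at times in [0, T], where sigma is
    invertible. *)
Lemma girsanov_ito (b : vec R d -> R -> vec R d) (sigma : vec R d -> R -> 'M[R]_d)
    (X Xu : {mfun O >-> pathSpace T xinit}) (u : vec R d -> R -> vec R d) :
  (forall x s, s \in `[0, T] -> sigma x s \in unitmx) ->
  girsanov_density P W b sigma X Xu u ->
  exists H I, [/\ is_ito_integral P W H I,
    forall s w, s \in `[0, T] -> H s w = u (ev (X w) s) s &
    {ae P, forall w, density (law P Xu) (law P X) (X w) =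
      (expR (I T w - 2^-1 * fine (l2norm2 T (H ^~ w))))%:E}].
Proof.
move=> sigma_unit [J [I HI JE] DE].
pose H s w := ((u (ev (X w) s) s)^T *m invmx (sigma (ev (X w) s) s)
                 *m sigma (ev (X w) s) s)^T.
have HE s w : s \in `[0, T] -> H s w = u (ev (X w) s) s.
  by move=> sT; rewrite /H mulmxKV ?trmxK// sigma_unit.
exists H, I; split; [exact: HI|exact: HE|].
move: JE DE; apply: filterS2 => w [_ ->] ->; congr (expR _)%:E.
have -> : \int[lebesgue_measure]_(s in `[0, T])
    dot (invmx (sigma (ev (X w) s) s) *m b (ev (X w) s) s) (u (ev (X w) s) s) =
  \int[lebesgue_measure]_(s in `[0, T])
    ((u (ev (X w) s) s)^T *m invmx (sigma (ev (X w) s) s) *m b (ev (X w) s) s) 0 0.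
  apply: eq_Rintegral => s _; rewrite -mulmxA -[RHS]/(dot _ _) !dotE.
  by apply: eq_bigr => i _; rewrite mulrC.
rewrite [X in X - _ = _]addrAC subrr add0r; congr (_ - _ * fine _).
apply: eq_integral => s; rewrite inE/= => sT; by rewrite HE.
Qed.

End path_laws.

Lemma measurable_expeR (R : realType) : measurable_fun [set: \bar R] (@expeR R).
Proof.
apply: (measurability _ (ErealGenOInfty.measurableE R)).
move=> /= _ [_ [a ->]] <-; rewrite setTI.
have [a0|a0] := ltP a 0.
  rewrite (_ : _ @^-1` _ = setT)//; apply/seteqP; split => // x _ /=.
  by rewrite in_itv/= andbT (lt_le_trans _ (expeR_ge0 x))// lte_fin.
have [y yE] := @expeR_total R a%:E a0.
rewrite (_ : _ @^-1` _ = `]y, +oo[%classic); first exact: emeasurable_itv.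
by apply/seteqP; split => x /=; rewrite !in_itv/= !andbT -yE lte_expeR.
Qed.

Section relative_error.
Context (R : realType) (d : nat) (T : R) (xinit : vec R d).
Context (dO : measure_display) (O : measurableType dO) (P : probability O R).
Hypothesis T_gt0 : 0 < T.
Variables (f : vec R d -> R -> R) (g : vec R d -> R).
Hypothesis f_meas : measurable_fun ([set: borelMx R d 1] `*` `[0, T]%classic)
              (fun z : borelMx R d 1 * R => f z.1 z.2).
Hypothesis g_meas : measurable_fun [set: borelMx R d 1] (g : borelMx R d 1 -> R).
Variables X Xu Xustar : {mfun O >-> pathSpace T xinit}.
Hypothesis ustar_opt : optimal P f g X Xustar.
Local Open Scope ereal_scope.

Let mexp : measurable_fun [set: pathSpace T xinit]
  (fun x : pathSpace T xinit => expeR (- work f g x)).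
Proof.
apply: measurableT_comp; first exact: measurable_expeR.
by apply: measurableT_comp => //; exact: measurable_work.
Qed.

Let exp_ge0 (x : pathSpace T xinit) : 0 <= expeR (- work f g x).
Proof. exact: expeR_ge0. Qed.

(** If this number were 0, its inverse would be 0 by convention, and optimality would give the law
    of [Xstar] total mass 0 instead of 1. *)
Lemma partition_function_gt0 : (0 < fine (partition_function P f g X))%R.
Proof.
have Z0 : (0 <= fine (partition_function P f g X))%R.
  by rewrite fine_ge0// integral_ge0// => w _; exact: expeR_ge0.
rewrite lt_def Z0 andbT; apply/eqP => Z00.
have := ustar_opt measurableT; rewrite probability_setT Z00 invr0.
under eq_integral do rewrite mule0.
by rewrite integral0 => h; have := @lte01 R; rewrite h ltxx.
Qed.

Lemma relative_errorE : law P X `<< law P Xu -> law P Xustar `<< law P Xu ->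
  relative_error P f g X Xu =
  sqrte (\int[law P Xu]_x ((rn (law P Xustar) (law P Xu) x - 1) ^+ 2)%:E).
Proof.
move=> XXu XsXu; have Z0 := partition_function_gt0.
rewrite /relative_error; set Z := fine _ in Z0 *.
have w_ae := importance_weight Z0 XXu XsXu mexp exp_ge0 ustar_opt.
have my : measurable_fun [set: pathSpace T xinit] (fun x : pathSpace T xinit =>
    fine (expeR (- work f g x) * density (law P X) (law P Xu) x)).
  apply: (measurableT_comp (fine_measurable measurableT)).
  by apply: emeasurable_funM => //; exact: measurable_density.
rewrite (variance_ae_rn (ltW Z0) XsXu)//.
- rewrite sqrteM ?lee_fin ?sqr_ge0// muleA /= sqrtr_sqr ger0_norm ?(ltW Z0)//.
  by rewrite -EFinM mulVf ?gt_eqF// mul1e.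
- exact: (measurableT_comp my).
- exact: ae_law w_ae.
Qed.

End relative_error.

(** * Lower bounds on the relative error by relative entropy and by control cost *)

Unset Implicit Arguments.

Theorem corollary3p2 (R : realType) (d : nat) (T : R) (T_gt0 : 0 < T)
  (dO : measure_display) (O : measurableType dO) (P : probability O R)
  (W : {mfun O >-> pathSpace T (0 : vec R d)}) (W_brownian : is_brownian P W)
  (xinit : vec R d)
  (b : vec R d -> R -> vec R d) (sigma : vec R d -> R -> 'M[R]_d)
  (f : vec R d -> R -> R) (g : vec R d -> R)
  (b_meas : measurable_coef T b) (sigma_meas : measurable_coef T sigma)
  (f_meas : measurable_fun ([set: borelMx R d 1] `*` `[0, T]%classic)
              (fun z : borelMx R d 1 * R => f z.1 z.2))
  (g_meas : measurable_fun [set: borelMx R d 1] (g : borelMx R d 1 -> R))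
  (sigma_unit : forall x s, s \in `[0, T] -> sigma x s \in unitmx)
  (X : {mfun O >-> pathSpace T xinit})
  (X_sol : unique_strong_solution P W sigma b X)
  (Z_fin : (partition_function P f g X < +oo)%E)
  (u ustar : vec R d -> R -> vec R d)
  (Xu Xustar : {mfun O >-> pathSpace T xinit})
  (u_adm : admissible P W b sigma X u Xu)
  (ustar_adm : admissible P W b sigma X ustar Xustar)
  (ustar_opt : optimal P f g X Xustar) :
  let delta x s := ustar x s - u x s in
  ((sqrte (expeR (KL (law P Xustar) (law P Xu)) - 1)
      <= relative_error P f g X Xu) /\
   (sqrte (expeR (\int[P]_w ((2^-1)%:E *
        \int[leb]_(s in `[0%R, T])
          (sqnorm (delta (ev (Xustar w) s) s))%:E)) - 1)
      <= relative_error P f g X Xu))%E.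
Proof.
move=> delta.
have [u_meas _ XXu XuX gir] := u_adm.
have [us_meas _ XXs XsX girs] := ustar_adm.
have XsXu : law P Xustar `<< law P Xu := null_dominates_trans XsX XXu.
set mu := law P X in XXu XuX XXs XsX.
set nu := law P Xu in XXu XuX XsXu *; set q := law P Xustar in XXs XsX XsXu *.
have r20 : (0 <= \int[nu]_x ((rn q nu x - 1) ^+ 2)%:E)%E.
  by apply: integral_ge0 => x _; rewrite lee_fin sqr_ge0.
rewrite (relative_errorE T_gt0 f_meas g_meas ustar_opt XXu XsXu).
rewrite !lee_sqrt//; split; first exact: expeR_KL_le.
have [H [I [HI HE dH]]] := girsanov_ito sigma_unit gir.
have [H' [I' [HI' HE' dH']]] := girsanov_ito sigma_unit girs.
(* If the chi-square integral is infinite the bound is trivial; otherwise [c] is the mean of D under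
   the optimal law. *)
move: r20 (chi_squareE XsXu).
case: (\int[nu]_x ((rn q nu x - 1) ^+ 2)%:E)%E => [r| |//]; last by move=> *; rewrite leey.
rewrite lee_fin => r0 cE; pose c := r + 1.
have c1 : 1 <= c by rewrite lerDr.
have TT : T \in `[0, T] by rewrite in_itv/= lexx ltW.
have mH := ito_jointly_measurable HI; have mH' := ito_jointly_measurable HI'.
pose a w := I T w - 2^-1 * fine (l2norm2 T (H ^~ w)).
pose s w := I' T w - 2^-1 * fine (l2norm2 T (H' ^~ w)).
pose bb w := 2^-1 * fine (l2norm2 T (fun t => H' t w - H t w)).
have ma : measurable_fun setT a.
  apply: measurable_funB; first by case: HI => _ /(_ _ TT).
  by apply: measurable_funM => //; exact: measurable_fine_l2norm2.
have ms : measurable_fun setT s.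
  apply: measurable_funB; first by case: HI' => _ /(_ _ TT).
  by apply: measurable_funM => //; exact: measurable_fine_l2norm2.
have mb : measurable_fun setT bb.
  apply: measurable_funM; first exact: measurable_cst.
  exact: (measurable_fine_l2norm2 (jointly_measurable_sub mH' mH)).
have bb0 w : 0 <= bb w by rewrite mulr_ge0 ?invr_ge0// fine_ge0// l2norm2_ge0.
have rnu : {ae P, forall w, rn nu mu (X w) = expR (a w)}.
  move: dH (ae_law (density_rn XuX)); apply: filterS2 => w h1 h2.
  by apply: EFin_inj; rewrite -h2 h1.
have rnq : {ae P, forall w, rn q mu (X w) = expR (s w)}.
  move: dH' (ae_law (density_rn XsX)); apply: filterS2 => w h1 h2.
  by apply: EFin_inj; rewrite -h2 h1.
(* The chain rule through the law of [Xu] gives D as a quotient, whose denominator e^a is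
   positive. *)
have rnqnu : {ae P, forall w, rn q nu (X w) = expR (s w - a w)}.
  move: (ae_law (rn_chain XsXu XuX)); move: rnu rnq; apply: filterS3 => w h1 h2.
  by rewrite h1 h2 expRB => ->; rewrite mulfK// gt_eqF// expR_gt0.
have mes : measurable_fun setT (fun w => expR (s w)) by exact: measurableT_comp.
have mrn := measurable_rn XsX; have mD := measurable_rn XsXu.
have rn0 x : 0 <= rn q mu x by exact: rn_ge0.
(* Transfers means under the optimal law to the uncontrolled process, weighted by its Girsanov
   density. *)
have change (F : pathSpace T xinit -> \bar R) : (forall x, 0 <= F x)%E ->
    measurable_fun setT F ->
    (\int[q]_x F x = \int[P]_w (F (X w) * (expR (s w))%:E))%E.
  move=> F0 mF; rewrite -(ge0_integral_rn XsX measurableT F0 mF).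
  have mrnE : measurable_fun setT (fun x => (rn q mu x)%:E) by exact/measurable_EFinP.
  have mFrn : measurable_fun setT (fun x => F x * (rn q mu x)%:E)%E.
    exact: emeasurable_funM.
  rewrite ge0_integral_distribution//; last by move=> x; rewrite mule_ge0 ?lee_fin.
  apply: ge0_ae_eq_integral => //.
  - exact: (measurableT_comp mFrn).
  - apply: emeasurable_funM; first exact: (measurableT_comp mF).
    exact/measurable_EFinP.
  - by move=> w _; rewrite /= mule_ge0 ?lee_fin.
  - by move=> w _; rewrite mule_ge0// lee_fin expR_ge0.
  - by apply: filterS rnq => w h _; rewrite /= h.
have Es : (\int[P]_w (expR (s w))%:E = 1)%E.
  have := change (cst 1%E); rewrite integral_cst//= probability_setT mule1 => -> //.
  by apply: eq_integral => w _; rewrite mul1e.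
have Ec : (\int[P]_w (expR (s w - a w) * expR (s w))%:E = c%:E)%E.
  rewrite /c EFinD -cE change//; last first.
  - exact/measurable_EFinP.
  - by move=> x; rewrite lee_fin rn_ge0.
  apply: ge0_ae_eq_integral => //.
  - apply/measurable_EFinP/measurable_funM => //.
    by apply: measurableT_comp => //; exact: measurable_funB.
  - apply: emeasurable_funM; last exact/measurable_EFinP.
    by apply/measurable_EFinP; exact: (measurableT_comp mD).
  - by move=> w _; rewrite mule_ge0// lee_fin ?expR_ge0// rn_ge0.
  - by apply: filterS rnqnu => w h _; rewrite h EFinM.
have bound := entropy_bound c1 ma ms mb bb0
  (integral_exp_ito_convex W_brownian T_gt0 HI HI') Es Ec.
(* The control cost has to be a measurable functional of the path alone, in order that its mean
   along [Xustar] depends only on the law and can be moved to [X]. *)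
pose Phi (x : pathSpace T xinit) := l2norm2 T (fun t => delta (ev x t) t).
have coord_along (v : vec R d -> R -> vec R d) : measurable_coef T v ->
    jointly_measurable T (fun t (x : pathSpace T xinit) => v (ev x t) t).
  move=> mv i.
  have mva := @measurable_along_path _ _ _ xinit T_gt0 _ (borelMx R d 1) v mv.
  exact: (@measurableT_comp _ _ _ _ _ R (fun M : borelMx R d 1 => M i 0) _ _
    (measurable_coord i 0) mva).
have mPhi : measurable_fun setT Phi.
  exact: (measurable_l2norm2
    (jointly_measurable_sub (coord_along _ us_meas) (coord_along _ u_meas))).
have PhiX w : Phi (X w) = l2norm2 T (fun t => H' t w - H t w).
  apply: eq_integral => t; rewrite inE/= => tT.
  by rewrite /delta HE ?HE'.
rewrite leeBlDr// -EFinD -/c.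
rewrite (_ : c%:E = expeR (ln c)%:E); last by rewrite /= lnK// posrE (lt_le_trans ltr01).
rewrite lee_expeR; apply: le_trans bound.
have -> : (\int[P]_w ((2^-1)%:E * \int[leb]_(t in `[0%R, T])
    (sqnorm (delta (ev (Xustar w) t) t))%:E) = \int[q]_x ((2^-1)%:E * Phi x))%E.
  rewrite ge0_integral_distribution//; first exact: measurable_funeM.
  by move=> x; rewrite mule_ge0 ?l2norm2_ge0// lee_fin invr_ge0.
rewrite change; last 2 first.
- by move=> x; rewrite mule_ge0 ?l2norm2_ge0// lee_fin invr_ge0.
- exact: measurable_funeM.
rewrite le_eqVlt; apply/orP; left; apply/eqP; apply: ge0_ae_eq_integral => //.
- apply: emeasurable_funM; last exact/measurable_EFinP.
  by apply: measurable_funeM; exact: (measurableT_comp mPhi).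
- by apply/measurable_EFinP; exact: measurable_funM.
- move=> w _; rewrite mule_ge0 ?lee_fin ?expR_ge0//.
  by rewrite mule_ge0 ?l2norm2_ge0// lee_fin invr_ge0.
- by move=> w _; rewrite lee_fin mulr_ge0// expR_ge0.
(* [bb] contains a [fine], which is faithful only where the norm of the difference is finite; this
   holds almost surely because both integrands are square integrable. *)
move: (ito_square_integrable T_gt0 HI) (ito_square_integrable T_gt0 HI').
apply: filterS2 => w Hw Hw' _; rewrite PhiX /bb.
have := l2norm2_lin_comb_fin_num HI HI' (-1) 1 Hw Hw'.
rewrite (_ : (fun s => _) = (fun s => H' s w - H s w)).
  by move=> /fineK <-; rewrite -!EFinM.
by apply/funext => t; rewrite scale1r scaleN1r addrC.
Qed.
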